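(* Let $n\ge1$ and let $x=(x_1,\dots,x_{2n})$ be indeterminates. Then \begin{align*} A^{(1)}_{\mathrm{UO}}(8n;x;\zeta_4)&=2^{-4n^2+4n}\prod_{i=1}^{2n}x_i^{-4n+4}\prod_{1\le i<j\le2n}(x_j^2+x_i^2)(1+x_i^2x_j^2)\,\operatorname{Hf}\Big(\frac{1}{(x_j^2+x_i^2)(1+x_i^2x_j^2)}\Big)_{1\le i,j\le2n},\\ A^{(1)}_{\mathrm{UO}}(8n;x;\zeta_6)&=3^{-2n^2+2n}\,\mathrm{Sp}_{4n}\big(\delta(n-1,n-1);x_1^2,\dots,x_{2n}^2\big)^2,\\ A^{(2)}_{\mathrm{UO}}(8n;x;\zeta_4,\zeta_4)&=2^{-4n^2+4n}\prod_{i=1}^{2n}x_i^{-4n+2}\prod_{1\le i<j\le2n}(x_j^2+x_i^2)(1+x_i^2x_j^2),\\ A^{(2)}_{\mathrm{UO}}(8n;x;\zeta_6,\zeta_4)&=3^{-2n^2+2n}\,\mathrm{Sp}_{4n}\big(\delta(n-1,n-1);x_1^2,\dots,x_{2n}^2\big)\,\tilde{\mathrm O}_{4n+1}\big(\delta(n,n-1);x_1^2,\dots,x_{2n}^2\big). \end{align*}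
   Context: $\sigma(t)=t-t^{-1}$, $\zeta_m=\exp(2\pi\sqrt{-1}/m)$. For parameters $a,c$ define skew-symmetric $2n\times2n$ matrices $M^{(1)}_{\mathrm{UO}}(n;x;a)_{ij}=\sigma(x_j/x_i)\sigma(x_ix_j)\Big(\dfrac{1}{\sigma(ax_ix_j)\sigma(a/(x_ix_j))}-\dfrac{1}{\sigma(ax_j/x_i)\sigma(ax_i/x_j)}\Big)$, $M^{(2)}_{\mathrm{UO}}(n;x;a,c)_{ij}=\sigma(x_j/x_i)\sigma(x_ix_j)\Big(\dfrac{\sigma(cx_i)\sigma(cx_j)}{\sigma(ax_ix_j)}-\dfrac{\sigma(cx_i)\sigma(c/x_j)}{\sigma(ax_i/x_j)}-\dfrac{\sigma(c/x_i)\sigma(cx_j)}{\sigma(ax_j/x_i)}+\dfrac{\sigma(c/x_i)\sigma(c/x_j)}{\sigma(a/(x_ix_j))}\Big)$, let $F_{\mathrm{UO}}(n;x;a)=\dfrac{\prod_{1\le i<j\le2n}\sigma(ax_i/x_j)\sigma(ax_j/x_i)\sigma(ax_ix_j)\sigma(a/(x_ix_j))}{\prod_{1\le i<j\le2n}\sigma(x_j/x_i)\prod_{1\le i\le j\le2n}\sigma(x_ix_j)}$, and $A^{(1)}_{\mathrm{UO}}(8n;x;a)=\sigma(a)^{-4n^2+4n}F_{\mathrm{UO}}(n;x;a)\operatorname{Pf}M^{(1)}_{\mathrm{UO}}(n;x;a)$, $A^{(2)}_{\mathrm{UO}}(8n;x;a,c)=\sigma(a)^{-4n^2+n}\sigma(c/a)^{-2n}\sigma(a^2)^{2n}F_{\mathrm{UO}}(n;x;a)\operatorname{Pf}M^{(2)}_{\mathrm{UO}}(n;x;a,c)$.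 $\operatorname{Hf}B$ (Hafnian of a symmetric $2n\times2n$ matrix) is the sum over all perfect matchings of $\{1,\dots,2n\}$ of the product of $B_{ij}$ over matched pairs. For $r\in\mathbb Z$, $\delta(r)=(r,r-1,\dots)$ consists of all $r-k\ge0$ ($k\in\mathbb Z_{\ge0}$), empty if $r<0$; $\delta(r,s)$ arranges the entries of $\delta(r),\delta(s)$ together in non-increasing order; as the index of a character in $N$ variables it is replaced by its first $N$ entries. For a partition $\lambda$ of length $\le N$ and $z=(z_1,\dots,z_N)$, $z_i=x_i^2$: $\mathrm{Sp}_{2N}(\lambda;z)=\det\big(z_i^{\lambda_j+N-j+1}-z_i^{-(\lambda_j+N-j+1)}\big)/\det\big(z_i^{N-j+1}-z_i^{-(N-j+1)}\big)$ and $\tilde{\mathrm O}_{2N+1}(\lambda;z)=\det\big(z_i^{\lambda_j+N-j+1/2}-z_i^{-(\lambda_j+N-j+1/2)}\big)/\det\big(z_i^{N-j+1/2}-z_i^{-(N-j+1/2)}\big)$, with $z_i^{r}:=x_i^{2r}$ for half-integers $r$.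
   Formalization: In the third identity the left side is 0/0 at a=c=ζ_4 (σ(c/a)=σ(a²)=0), so it is stated as: with c=ζ_4 fixed, the rational function a ↦ A^(2)_UO(8n;x;a,ζ_4) has no pole at a=ζ_4 and takes the stated value there. *)

(* Defs.v *)
From HB Require Import structures.
From mathcomp Require Import all_boot all_order all_algebra all_fingroup.
From mathcomp Require Import fraction complex.
From mathcomp Require Import reals.
From mathcomp Require trigo mpoly.

Set Implicit Arguments.
Unset Strict Implicit.
Unset Printing Implicit Defensive.

Import Order.TTheory GRing.Theory Num.Theory.
Local Open Scope ring_scope.

(* trigo and mpoly declare incompatible notations, hence the separate local
   imports. *)
Module Zeta.
Import trigo.

(* exp(2 pi i / m) *)
Definition zeta (R : realType) (m : nat) : R[i] :=
  (cos (2 * pi / m%:R) +i* sin (2 * pi / m%:R))%C.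

End Zeta.

Module RatFun.
Import mpoly.

Definition ratfun (F : fieldType) (m : nat) : fieldType :=
  {fraction {mpoly F[m]}}.

Definition ratfun_const (F : fieldType) (m : nat) (a : F) : ratfun F m :=
  tofrac (a%:MP_[m]).

Definition ratfun_var (F : fieldType) (m : nat) (i : 'I_m) : ratfun F m :=
  tofrac ('X_i : {mpoly F[m]}).

End RatFun.

Export Zeta RatFun.

Definition uratfun (K : fieldType) : fieldType := {fraction {poly K}}.

Definition uratfun_const (K : fieldType) (a : K) : uratfun K := tofrac a%:P.

Definition uratfun_var (K : fieldType) : uratfun K := tofrac ('X : {poly K}).

(* f has no pole at a, and f(a) = v *)
Definition has_value_at (K : fieldType) (f : uratfun K) (a v : K) : Prop :=
  exists p q : {poly K},
    [/\ q.[a] != 0, f = tofrac p / tofrac q & v = p.[a] / q.[a]].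

Section Matchings.

Variable n : nat.

Lemma pair_fst_proof (k : 'I_n) : (k.*2 < n.*2)%N.
Proof. by rewrite ltn_double. Qed.

Lemma pair_snd_proof (k : 'I_n) : (k.*2.+1 < n.*2)%N.
Proof. by rewrite ltn_Sdouble. Qed.

Definition pair_fst (k : 'I_n) : 'I_n.*2 := Ordinal (pair_fst_proof k).
Definition pair_snd (k : 'I_n) : 'I_n.*2 := Ordinal (pair_snd_proof k).

(* A perfect matching {i_1,j_1}, ..., {i_n,j_n} is written in exactly one way
   with i_k < j_k for all k and i_1 < ... < i_n; it is encoded by the
   permutation with values i_1, j_1, i_2, j_2, ..., i_n, j_n. *)
Definition perfect_matching (s : 'S_n.*2) : bool :=
  [forall k : 'I_n, s (pair_fst k) < s (pair_snd k)]%N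
  && [forall k : 'I_n, forall l : 'I_n,
        (k < l)%N ==> (s (pair_fst k) < s (pair_fst l))%N].

Definition Pf (F : fieldType) (A : 'M[F]_n.*2) : F :=
  \sum_(s : 'S_n.*2 | perfect_matching s)
     (-1) ^+ s * \prod_(k < n) A (s (pair_fst k)) (s (pair_snd k)).

Definition Hf (F : fieldType) (A : 'M[F]_n.*2) : F :=
  \sum_(s : 'S_n.*2 | perfect_matching s)
     \prod_(k < n) A (s (pair_fst k)) (s (pair_snd k)).

End Matchings.

Definition sigma (F : fieldType) (t : F) : F := t - t^-1.

Section UO.

Variables (F : fieldType) (n : nat) (x : 'I_n.*2 -> F).

Definition M1_UO (a : F) : 'M[F]_n.*2 :=
  \matrix_(i, j)
    (sigma (x j / x i) * sigma (x i * x j)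
     * ((sigma (a * x i * x j) * sigma (a / (x i * x j)))^-1
        - (sigma (a * x j / x i) * sigma (a * x i / x j))^-1)).

Definition M2_UO (a c : F) : 'M[F]_n.*2 :=
  \matrix_(i, j)
    (sigma (x j / x i) * sigma (x i * x j)
     * (sigma (c * x i) * sigma (c * x j) / sigma (a * x i * x j)
        - sigma (c * x i) * sigma (c / x j) / sigma (a * x i / x j)
        - sigma (c / x i) * sigma (c * x j) / sigma (a * x j / x i)
        + sigma (c / x i) * sigma (c / x j) / sigma (a / (x i * x j)))).

Definition F_UO (a : F) : F :=
  (\prod_(i < n.*2) \prod_(j < n.*2 | (i < j)%N)
     (sigma (a * x i / x j) * sigma (a * x j / x i)
      * sigma (a * x i * x j) * sigma (a / (x i * x j))))
  / ((\prod_(i < n.*2) \prod_(j < n.*2 | (i < j)%N) sigma (x j / x i))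
     * (\prod_(i < n.*2) \prod_(j < n.*2 | (i <= j)%N) sigma (x i * x j))).

Definition A1_UO (a : F) : F :=
  sigma a ^ (- (4 * n ^ 2)%:Z + (4 * n)%:Z) * F_UO a * Pf (M1_UO a).

(* For a = c = zeta_4 the factor sigma(c/a)^(-2n) sigma(a^2)^(2n) is 0/0. Once c
   is fixed to zeta_4 the singularity in a is removable, as
   sigma(zeta_4/a) = zeta_4 (a + a^-1) and sigma(a^2) = sigma(a) (a + a^-1); the
   value at a = c = zeta_4 is therefore expressed with has_value_at, for a an
   indeterminate over F. *)
Definition A2_UO (a c : F) : F :=
  sigma a ^ (- (4 * n ^ 2)%:Z + n%:Z) * sigma (c / a) ^ (- (2 * n)%:Z)
  * sigma (a ^+ 2) ^+ (2 * n) * F_UO a * Pf (M2_UO a c).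

End UO.

Definition delta (r : int) : seq nat :=
  if r is Posz m then rev (iota 0 m.+1) else [::].

Definition delta2 (r s : int) : seq nat := sort geq (delta r ++ delta s).

(* Partitions are sequences padded with zeros. As the columns j range over 'I_N
   only the first N parts of la matter. Indices start at 0 here, so the part
   lambda_(j+1) is nth 0 la j and N - (j+1) + 1 is N - j. *)
Definition Sp_char (F : fieldType) (N : nat) (la : seq nat) (z : 'I_N -> F) : F :=
  let alternant (mu : seq nat) := \det (\matrix_(i < N, j < N)
    (z i ^+ (nth 0%N mu j + (N - j))%N - z i ^- (nth 0%N mu j + (N - j))%N)) in
  alternant la / alternant [::].

(* The odd orthogonal character of index la at z_i = x_i^2. The half-integer
   powers z_i^r are x_i^(2r), and 2 (lambda_(j+1) + N - (j+1) + 1/2) is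
   2 (lambda_(j+1) + (N - j)) - 1. *)
Definition tildeO_char (F : fieldType) (N : nat) (la : seq nat) (x : 'I_N -> F)
    : F :=
  let alternant (mu : seq nat) := \det (\matrix_(i < N, j < N)
    (x i ^+ (2 * (nth 0%N mu j + (N - j)) - 1)%N
     - x i ^- (2 * (nth 0%N mu j + (N - j)) - 1)%N)) in
  alternant la / alternant [::].

(* Main.v *)
Require Import Defs.
From mathcomp Require Import all_boot all_order all_algebra all_fingroup.
From mathcomp Require Import complex reals.
From mathcomp Require Import fraction ring lra zify.
From mathcomp Require trigo mpoly.

(** Put [t_i = x_i^2 + x_i^-2] and [al = a^2 + a^-2]. Up to the factors
    [sigma(x_i^2) sigma(x_j^2)], the entries of both matrices are rational
    functions of [t_i], [t_j] with denominator
    [q_ij = al^2 - al t_i t_j + t_i^2 + t_j^2 - 4], and the same [q_ij] make up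
    the numerator of [F_UO].

    At [a = zeta_4] one has [q_ij = (t_i + t_j)^2], and the Pfaffians are those of
    [(t_j - t_i) / (t_j + t_i)] (Schur) and of [(t_j - t_i) / (t_j + t_i)^2], a
    product of a Schur Pfaffian and a Hafnian. At [a = zeta_6] one has
    [q_ij = (tau_j - tau_i) / (t_j - t_i)] with [tau = t^3 - 3 t = x^6 + x^-6], and
    both Pfaffians are of the form [(t_j - t_i) (b_j - b_i) / (tau_j - tau_i)].

    The latter equals [W(tau, t) W(tau, b) / prod_{i<j} (tau_j - tau_i)], where
    [W(tau, b)] is the determinant with columns [1, b, tau, b tau, tau^2, ...]. All
    Pfaffian evaluations are proved by expanding along the first row and
    interpolating in the first variable; Schur's is the case [b = t],
    [tau = t^2]. Finally [W(tau, t)] and [W(tau, t^2 + t - 1)], divided by the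
    Vandermonde determinant of the [t_i], are the two characters: the alternants
    [z^e - z^-e] over the exponents [e] prime to 3 (resp. [x^e - x^-e] over [e]
    prime to 6) are unitriangular combinations of the columns of [W]. *)

Set Implicit Arguments.
Unset Strict Implicit.
Unset Printing Implicit Defensive.

Import Order.TTheory GRing.Theory Num.Theory.
Local Open Scope ring_scope.

(** * Expansion of Pfaffians and Hafnians *)

Lemma lift_perm_inj n (i j : 'I_n.+1) : injective (lift_perm i j).
Proof.
move=> s t est; apply/permP => k; apply: (@lift_inj _ j).
by rewrite -!(lift_perm_lift i j) est.
Qed.

Lemma lift_perm_onto n (i j : 'I_n.+1) (s : 'S_n.+1) :
  s i = j -> exists t, s = lift_perm i j t.
Proof.
move=> sij; pose f k := odflt k (unlift j (s (lift i k))).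
have fK k : lift j (f k) = s (lift i k).
  rewrite /f; have := neq_lift i k.
  by rewrite -(can_eq (permK s)) sij => /unlift_some [] ? ? ->.
have f_inj : injective f.
  by move=> k l /(congr1 (lift j)); rewrite !fK => /perm_inj /lift_inj.
exists (perm f_inj); apply/permP => k.
case: (unliftP i k) => [k'|] ->; last by rewrite lift_perm_id.
by rewrite lift_perm_lift permE fK.
Qed.

Section MatchingLift.

Variable n : nat.

(** Encodes the matching that pairs [0] with [j + 1] and continues with [s] on the remaining points:
    the inner [lift_perm] puts [j] in front of [s], the outer one puts [0] in front of that. *)
Definition matching_lift (j : 'I_n.*2.+1) (s : 'S_n.*2) : 'S_n.+1.*2 :=
  lift_perm ord0 ord0 (lift_perm ord0 j s).

Definition lift2 (j : 'I_n.*2.+1) (p : 'I_n.*2) : 'I_n.+1.*2 :=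
  lift ord0 (lift j p).

Lemma pair_fst0 : pair_fst (ord0 : 'I_n.+1) = ord0. Proof. exact: val_inj. Qed.

Lemma pair_snd0 : pair_snd (ord0 : 'I_n.+1) = lift ord0 (ord0 : 'I_n.*2.+1).
Proof. exact: val_inj. Qed.

Lemma pair_fst_lift (k : 'I_n) : pair_fst (lift ord0 k) = lift2 ord0 (pair_fst k).
Proof. exact: val_inj. Qed.

Lemma pair_snd_lift (k : 'I_n) : pair_snd (lift ord0 k) = lift2 ord0 (pair_snd k).
Proof. exact: val_inj. Qed.

Variables (j : 'I_n.*2.+1) (s : 'S_n.*2).

Lemma matching_lift_fst0 : matching_lift j s (pair_fst ord0) = ord0.
Proof. by rewrite pair_fst0 lift_perm_id. Qed.

Lemma matching_lift_snd0 : matching_lift j s (pair_snd ord0) = lift ord0 j.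
Proof. by rewrite pair_snd0 lift_perm_lift lift_perm_id. Qed.

Lemma matching_lift_fst k :
  matching_lift j s (pair_fst (lift ord0 k)) = lift2 j (s (pair_fst k)).
Proof. by rewrite pair_fst_lift !lift_perm_lift. Qed.

Lemma matching_lift_snd k :
  matching_lift j s (pair_snd (lift ord0 k)) = lift2 j (s (pair_snd k)).
Proof. by rewrite pair_snd_lift !lift_perm_lift. Qed.

(** Moving the value [j] to the front costs [j] transpositions; this is the sign [(-1) ^+ j] of
    [Pf_expand]. *)
Lemma odd_matching_lift : matching_lift j s = odd j (+) s :> bool.
Proof. by rewrite /matching_lift !odd_lift_perm. Qed.

Lemma ltn_lift2 (p q : 'I_n.*2) : (lift2 j p < lift2 j q)%N = (p < q)%N.
Proof. by rewrite /lift2 /= /bump /= !add1n ltnS !ltnNge leq_bump2. Qed.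

Lemma perfect_matching_lift :
  perfect_matching (matching_lift j s) = perfect_matching s.
Proof.
apply/andP/andP => -[/forallP lt1 /forallP lt2]; split.
- apply/forallP => k; have := lt1 (lift ord0 k).
  by rewrite matching_lift_fst matching_lift_snd ltn_lift2.
- apply/forallP => k; apply/forallP => l; apply/implyP => kl.
  have /forallP/(_ (lift ord0 l))/implyP := lt2 (lift ord0 k).
  by rewrite !matching_lift_fst ltn_lift2; apply; rewrite !lift0.
- apply/forallP => k; case: (unliftP ord0 k) => [k'|] ->.
    by rewrite matching_lift_fst matching_lift_snd ltn_lift2.
  by rewrite matching_lift_fst0 matching_lift_snd0.
- apply/forallP => k; apply/forallP => l; apply/implyP.
  case: (unliftP ord0 k) => [k'|] ->; case: (unliftP ord0 l) => [l'|] -> //.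
    rewrite !lift0 ltnS => kl; rewrite !matching_lift_fst ltn_lift2.
    by have /forallP/(_ l')/implyP := lt2 k'; apply.
  by rewrite matching_lift_fst0 matching_lift_fst.
Qed.

End MatchingLift.

Lemma pair_cases n (p : 'I_n.*2) :
  exists k : 'I_n, p = pair_fst k \/ p = pair_snd k.
Proof.
have kP : (p./2 < n)%N by rewrite ltn_half_double.
exists (Ordinal kP); have := odd_double_half p.
case: (odd p) => /= e; [right|left]; apply: val_inj => /=.
  by rewrite -[LHS]e.
by rewrite -[LHS]e.
Qed.

(** The value [0] cannot be the larger entry of its pair, and since the smaller entries increase,
    its pair comes first. *)
Lemma perfect_matching0 n (s : 'S_n.+1.*2) : perfect_matching s -> s ord0 = ord0.
Proof.
move=> /andP[/forallP lt1 /forallP lt2].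
have [k []] := pair_cases ((s^-1)%g ord0) => e0; have := permKV s ord0;
  rewrite e0 => e.
  case: (unliftP ord0 k) => [k'|] ek; last by rewrite ek pair_fst0 in e.
  by have /forallP/(_ k)/implyP := lt2 ord0; rewrite e ek => /(_ isT).
by have := lt1 k; rewrite e.
Qed.

Section Expansion.

Variables (F : fieldType) (n : nat).

(** The images of the maps [matching_lift j] partition the permutations fixing [0]. The predicates
    are left free so that one reindexing serves perfect matchings and, with [predT], all
    permutations. *)
Lemma sum_matching_lift (P : pred 'S_n.*2) (Q : pred 'S_n.+1.*2)
    (f : 'S_n.+1.*2 -> F) :
    (forall j s, Q (matching_lift j s) = P s) ->
    (forall s, Q s -> s ord0 = ord0) ->
  \sum_(s | Q s) f s = \sum_j \sum_(s | P s) f (matching_lift j s).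
Proof.
move=> QP Q0; rewrite pair_big /=.
pose h (p : 'I_n.*2.+1 * 'S_n.*2) := matching_lift p.1 p.2.
rewrite -(big_imset f (h := h) (A := [pred p | P p.2])) /=.
  apply: eq_bigl => s; apply/idP/imsetP => [Qs|[[j t]]]; last first.
    by rewrite inE /= => Pt ->; rewrite /h QP.
  have [t et] := lift_perm_onto (Q0 _ Qs).
  have [u eu] := lift_perm_onto (erefl (t ord0)).
  exists (t ord0, u); last by rewrite /h /matching_lift -eu.
  by rewrite inE /= -(QP (t ord0)) /matching_lift -eu -et.
move=> [j s] [k t] _ _; rewrite /h /= => /lift_perm_inj e.
have ejk : j = k by rewrite -(lift_perm_id ord0 j s) e lift_perm_id.
by move: e; rewrite ejk => /lift_perm_inj ->.
Qed.

Lemma prod_matching_lift (A : 'M[F]_n.+1.*2) j s :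
  \prod_(k < n.+1) A (matching_lift j s (pair_fst k))
                     (matching_lift j s (pair_snd k))
  = A ord0 (lift ord0 j)
    * \prod_(k < n) mxsub (lift2 j) (lift2 j) A (s (pair_fst k)) (s (pair_snd k)).
Proof.
rewrite big_ord_recl matching_lift_fst0 matching_lift_snd0; congr (_ * _).
by apply: eq_bigr => k _; rewrite matching_lift_fst matching_lift_snd mxE.
Qed.

Lemma Pf_expand (A : 'M[F]_n.+1.*2) :
  Pf A = \sum_(j < n.*2.+1) (-1) ^+ j * A ord0 (lift ord0 j)
                           * Pf (mxsub (lift2 j) (lift2 j) A).
Proof.
rewrite /Pf (@sum_matching_lift (@perfect_matching n)); last 2 first.
- exact: perfect_matching_lift.
- exact: perfect_matching0.
apply: eq_bigr => j _; rewrite big_distrr; apply: eq_bigr => s _ /=.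
rewrite prod_matching_lift odd_matching_lift signr_addb signr_odd.
by rewrite mulrACA.
Qed.

Lemma Hf_expand (A : 'M[F]_n.+1.*2) :
  Hf A = \sum_(j < n.*2.+1) A ord0 (lift ord0 j)
                           * Hf (mxsub (lift2 j) (lift2 j) A).
Proof.
rewrite /Hf (@sum_matching_lift (@perfect_matching n)); last 2 first.
- exact: perfect_matching_lift.
- exact: perfect_matching0.
apply: eq_bigr => j _; rewrite big_distrr; apply: eq_bigr => s _ /=.
by rewrite prod_matching_lift.
Qed.

End Expansion.

Lemma perfect_matching_ord0 (s : 'S_0.*2) : perfect_matching s.
Proof. by apply/andP; split; apply/forallP => -[]. Qed.

Lemma perm_ord0 (s : 'S_0.*2) : s = 1%g.
Proof. by apply/permP => -[]. Qed.

Lemma Pf0 (F : fieldType) (A : 'M[F]_0.*2) : Pf A = 1.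
Proof.
rewrite /Pf (big_pred1 1%g) ?odd_perm1 ?big_ord0 ?mul1r // => s.
by rewrite perfect_matching_ord0 [s]perm_ord0 /= eqxx.
Qed.

Lemma Hf0 (F : fieldType) (A : 'M[F]_0.*2) : Hf A = 1.
Proof.
rewrite /Hf (big_pred1 1%g) ?big_ord0 // => s.
by rewrite perfect_matching_ord0 [s]perm_ord0 /= eqxx.
Qed.

(* Summing over all permutations instead of perfect matchings counts each
   matching [2 ^ n * n!] times, but is visibly alternating. *)
Definition Pf_full (F : fieldType) n (A : 'M[F]_n.*2) : F :=
  \sum_(s : 'S_n.*2)
     (-1) ^+ s * \prod_(k < n) A (s (pair_fst k)) (s (pair_snd k)).

(** * Vanishing of a Pfaffian with two equal rows *)

Section FullExpansion.

Variables (F : fieldType) (n : nat) (A : 'M[F]_n.*2).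
Hypothesis antisymA : forall i j, A j i = - A i j.

Let term (s : 'S_n.*2) :=
  (-1) ^+ s * \prod_(k < n) A (s (pair_fst k)) (s (pair_snd k)).

Lemma pair_fst_inj : injective (@pair_fst n).
Proof. by move=> k l /(congr1 val) /double_inj /val_inj. Qed.

Lemma pair_snd_inj : injective (@pair_snd n).
Proof. by move=> k l /(congr1 val) [] /double_inj /val_inj. Qed.

Lemma pair_fst_snd (k l : 'I_n) : (pair_fst k == pair_snd l) = false.
Proof.
by apply/eqP => /(congr1 (odd \o val)) /=; rewrite !odd_double.
Qed.

(** The transposition changes the sign, and antisymmetry of [A] changes it back. *)
Lemma Pf_full_swap (k : 'I_n) (s : 'S_n.*2) :
  term (tperm (pair_fst k) (pair_snd k) * s)%g = term s.
Proof.
rewrite /term odd_permM odd_tperm pair_fst_snd /= signrN.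
rewrite (bigD1 k) //= [in RHS](bigD1 k) //= !permM tpermL tpermR antisymA.
rewrite !mulNr mulrN opprK; congr (_ * (_ * _)).
apply: eq_bigr => l lk; rewrite !permM.
by rewrite !tpermD // ?(inj_eq pair_fst_inj) ?(inj_eq pair_snd_inj)
  1?eq_sym ?pair_fst_snd // eq_sym ?pair_fst_snd.
Qed.

(** The two transpositions have the same parity, so the sign is unchanged, and the factors of the
    product are merely permuted. *)
Lemma Pf_full_exchange (k l : 'I_n) (s : 'S_n.*2) :
  term (tperm (pair_fst k) (pair_fst l) * (tperm (pair_snd k) (pair_snd l) * s))%g
  = term s.
Proof.
rewrite /term !odd_permM !odd_tperm (inj_eq pair_fst_inj) (inj_eq pair_snd_inj).
rewrite addbA addbb addFb; congr (_ * _).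
rewrite (reindex_inj (@perm_inj _ (tperm k l))) /=.
apply: eq_bigr => m _; rewrite !permM.
rewrite [tperm (pair_fst _) _ (pair_snd _)]tpermD ?pair_fst_snd //.
rewrite -(inj_tperm _ _ _ pair_fst_inj) -(inj_tperm _ _ _ pair_snd_inj) !tpermK.
by rewrite tpermD // eq_sym pair_fst_snd.
Qed.

End FullExpansion.

(** Permutations are sorted by the position of the value [0]. Exchanging pairs, and swapping inside
    a pair if needed, carries each of the [2 (n + 1)] positions to the first, so all contribute the
    same sum. *)
Lemma Pf_full_expand (F : fieldType) n (A : 'M[F]_n.+1.*2) :
    (forall i j, A j i = - A i j) ->
  Pf_full A = (\sum_(j < n.*2.+1) (-1) ^+ j * A ord0 (lift ord0 j)
                 * Pf_full (mxsub (lift2 j) (lift2 j) A)) *+ n.+1.*2.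
Proof.
move=> antisymA.
have first_row : \sum_(s : 'S_n.+1.*2 | s (pair_fst ord0) == ord0)
     (-1) ^+ s * \prod_(k < n.+1) A (s (pair_fst k)) (s (pair_snd k))
  = \sum_(j < n.*2.+1) (-1) ^+ j * A ord0 (lift ord0 j)
                 * Pf_full (mxsub (lift2 j) (lift2 j) A).
  rewrite (@sum_matching_lift _ _ predT).
  - apply: eq_bigr => j _; rewrite big_distrr; apply: eq_bigr => s _ /=.
    rewrite prod_matching_lift odd_matching_lift signr_addb signr_odd.
    by rewrite mulrACA.
  - by move=> j s; rewrite matching_lift_fst0 eqxx.
  - by move=> s /eqP; rewrite pair_fst0.
rewrite -first_row /Pf_full (partition_big (fun s : 'S_n.+1.*2 => (s^-1)%g ord0) predT) //=.
rewrite (eq_bigr (fun=> \sum_(s : 'S_n.+1.*2 | s (pair_fst ord0) == ord0)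
     (-1) ^+ s * \prod_(k < n.+1) A (s (pair_fst k)) (s (pair_snd k)))).
  by rewrite sumr_const card_ord.
move=> p _.
have invE (q : 'I_n.+1.*2) (s : 'S_n.+1.*2) :
  ((s^-1)%g ord0 == q) = (s q == ord0).
  by apply/eqP/eqP => [<-|<-]; rewrite ?permKV ?permK.
under eq_bigl => s do rewrite invE.
have fstP k : \sum_(s : 'S_n.+1.*2 | s (pair_fst k) == ord0)
     (-1) ^+ s * \prod_(k < n.+1) A (s (pair_fst k)) (s (pair_snd k))
  = \sum_(s : 'S_n.+1.*2 | s (pair_fst ord0) == ord0)
     (-1) ^+ s * \prod_(k < n.+1) A (s (pair_fst k)) (s (pair_snd k)).
  rewrite [RHS](reindex_inj (mulgI (tperm (pair_fst ord0) (pair_fst k)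
            * tperm (pair_snd ord0) (pair_snd k))%g)) /=.
  apply: eq_big => s; last first.
    by move=> _; rewrite -mulgA -(Pf_full_exchange _ ord0 k).
  by rewrite !permM tpermL tpermD // eq_sym pair_fst_snd.
have [k [] ->] := pair_cases p; first exact: fstP.
rewrite -(fstP k) (reindex_inj (mulgI (tperm (pair_fst k) (pair_snd k)))) /=.
apply: eq_big => s; last by move=> _; rewrite Pf_full_swap.
by rewrite permM tpermR.
Qed.

Lemma Pf_fullE (F : fieldType) n (A : 'M[F]_n.*2) :
  (forall i j, A j i = - A i j) -> Pf_full A = Pf A *+ (2 ^ n * n`!).
Proof.
elim: n A => [|n IHn] A antisymA.
  rewrite Pf0 /Pf_full (big_pred1 1%g) ?odd_perm1 ?big_ord0 ?mul1r //.
  by move=> s; rewrite [s]perm_ord0 /= eqxx.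
rewrite Pf_full_expand // Pf_expand.
have -> : (2 ^ n.+1 * n.+1`! = (2 ^ n * n`!) * n.+1.*2)%N.
  by rewrite expnS factS -mul2n; ring.
rewrite mulrnA; congr (_ *+ _); rewrite -sumrMnl; apply: eq_bigr => j _.
by rewrite IHn ?mulrnAr // => p q; rewrite !mxE.
Qed.

(** Transposing [i0] and [i1] fixes the matrix and reverses the sign of [Pf_full], which therefore
    vanishes. Characteristic zero permits division by [2] and by the multiplicity from
    [Pf_fullE]. *)
Lemma Pf_eq_rows (F : fieldType) n (A : 'M[F]_n.*2) i0 i1 :
    [pchar F] =i pred0 -> (forall i j, A j i = - A i j) ->
    i0 != i1 -> (forall j, A i0 j = A i1 j) ->
  Pf A = 0.
Proof.
move=> F0 antisymA i01 eqA.
have nat0 m : (m.+1%:R == 0 :> F) = false by rewrite (pcharf0P F).1.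
have eqAt i : A (tperm i0 i1 i) =1 A i by case: tpermP => [->|->|].
have eqAtt i j : A (tperm i0 i1 i) (tperm i0 i1 j) = A i j.
  by rewrite eqAt antisymA eqAt -antisymA.
have fullN : Pf_full A = - Pf_full A.
  rewrite {1}/Pf_full (reindex_inj (mulIg (tperm i0 i1))) /= -sumrN.
  apply: eq_bigr => s _; rewrite odd_permM odd_tperm i01 addbT signrN mulNr.
  by congr (- (_ * _)); apply: eq_bigr => k _; rewrite !permM eqAtt.
have full0 : Pf_full A = 0.
  have : Pf_full A *+ 2 = 0 by rewrite mulr2n {1}fullN addNr.
  by move/eqP; rewrite -mulr_natr mulf_eq0 nat0 orbF => /eqP.
move/eqP: full0; rewrite Pf_fullE // -mulr_natr mulf_eq0 => /orP[/eqP //|].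
have : (0 < 2 ^ n * n`!)%N by rewrite muln_gt0 expn_gt0 fact_gt0.
by case: (2 ^ n * n`!)%N => // m _; rewrite nat0.
Qed.

Section Scaling.

Variables (F : fieldType) (n : nat).

Lemma prod_pairs (h : 'I_n.*2 -> F) :
  \prod_(k < n) (h (pair_fst k) * h (pair_snd k)) = \prod_i h i.
Proof.
have halfP (i : 'I_n.*2) : (i./2 < n)%N by rewrite ltn_half_double.
rewrite (partition_big (fun i => Ordinal (halfP i)) predT) //=.
apply: eq_bigr => k _.
rewrite (bigD1 (pair_fst k)) /=; last by apply/eqP/val_inj; rewrite /= doubleK.
rewrite (big_pred1 (pair_snd k)) // => i /=.
apply/andP/eqP => [[/eqP e ne]|->]; last first.
  split; last by rewrite eq_sym pair_fst_snd.
  by apply/eqP/val_inj; rewrite /= uphalf_double.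
have [l [el|el]] := pair_cases i; have : l = k.
- by rewrite -e; apply: val_inj; rewrite el /= doubleK.
- by move=> elk; rewrite el elk eqxx in ne.
- by rewrite -e; apply: val_inj; rewrite el /= uphalf_double.
- by rewrite el => ->.
Qed.

(** Matchings read only entries above the diagonal. This lets entries be rewritten under hypotheses,
    such as nonzero denominators, known for [i < j] only. *)
Lemma eq_Pf (A B : 'M[F]_n.*2) :
  (forall i j : 'I_n.*2, (i < j)%N -> A i j = B i j) -> Pf A = Pf B.
Proof.
move=> eqAB; apply: eq_bigr => s /andP[/forallP lt1 _].
by congr (_ * _); apply: eq_bigr => k _; apply: eqAB.
Qed.

Lemma eq_Hf (A B : 'M[F]_n.*2) :
  (forall i j : 'I_n.*2, (i < j)%N -> A i j = B i j) -> Hf A = Hf B.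
Proof.
move=> eqAB; apply: eq_bigr => s /andP[/forallP lt1 _].
by apply: eq_bigr => k _; apply: eqAB.
Qed.

Lemma Pf_scale c (d : 'I_n.*2 -> F) (A : 'M[F]_n.*2) :
  Pf (\matrix_(i, j) (c * (d i * d j) * A i j)) = c ^+ n * (\prod_i d i) * Pf A.
Proof.
rewrite /Pf big_distrr; apply: eq_bigr => s _ /=; rewrite mulrCA; congr (_ * _).
under eq_bigr do rewrite mxE.
rewrite !big_split /= -big_split (prod_pairs (fun i => d (s i))) prodr_const.
by rewrite card_ord -(reindex_inj (@perm_inj _ s) (P := predT)).
Qed.

Lemma Hf_scale (d : 'I_n.*2 -> F) (A : 'M[F]_n.*2) :
  Hf (\matrix_(i, j) (d i * d j * A i j)) = (\prod_i d i) * Hf A.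
Proof.
rewrite /Hf big_distrr; apply: eq_bigr => s _ /=.
under eq_bigr do rewrite mxE.
rewrite !big_split /= -big_split (prod_pairs (fun i => d (s i))).
by rewrite -(reindex_inj (@perm_inj _ s) (P := predT)).
Qed.

End Scaling.

(** * Pfaffians of bialternant type *)

Lemma eq_poly_interp (F : fieldType) (I : finType) (r : I -> F) (p q : {poly F}) :
    injective r -> (size p <= #|I|)%N -> (size q <= #|I|)%N ->
    (forall i, p.[r i] = q.[r i]) ->
  p = q.
Proof.
move=> r_inj sp sq eqpq; apply/eqP; rewrite -subr_eq0; apply/eqP.
apply: (@roots_geq_poly_eq0 _ _ (codom r)).
- by apply/allP => _ /codomP[i ->]; rewrite rootE !hornerE eqpq subrr.
- by rewrite map_inj_uniq ?enum_uniq.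
- rewrite size_codom (leq_trans (size_polyD _ _)) //.
  by rewrite size_polyN geq_max sp.
Qed.

Section ProdLt.

Variable F : fieldType.

Definition prod_lt m (g : 'I_m -> 'I_m -> F) :=
  \prod_(i < m) \prod_(j < m | (i < j)%N) g i j.

Lemma eq_prod_lt m (g h : 'I_m -> 'I_m -> F) :
  (forall i j : 'I_m, (i < j)%N -> g i j = h i j) -> prod_lt g = prod_lt h.
Proof. by move=> egh; apply: eq_bigr => i _; apply: eq_bigr => j; apply: egh. Qed.

Lemma prod_lt_neq0 m (g : 'I_m -> 'I_m -> F) :
  (forall i j : 'I_m, (i < j)%N -> g i j != 0) -> prod_lt g != 0.
Proof.
by move=> g0; apply/prodf_neq0 => i _; apply/prodf_neq0 => j; apply: g0.
Qed.

Lemma prod_ltM m (g h : 'I_m -> 'I_m -> F) :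
  prod_lt (fun i j => g i j * h i j) = prod_lt g * prod_lt h.
Proof. by rewrite /prod_lt -big_split; apply: eq_bigr => i _; rewrite big_split. Qed.

(** Collects the factors that involve the index [j]. Those with a smaller partner, [j] in number,
    are turned around at the cost of [e] each; [e] is [-1] for differences and [1] for sums. *)
Lemma prod_lt_lift m (g : 'I_m.+1 -> 'I_m.+1 -> F) e (j : 'I_m.+1) :
    (forall i k, g i k = e * g k i) ->
  prod_lt g = e ^+ j * (\prod_p g j (lift j p))
                * prod_lt (fun p q => g (lift j p) (lift j q)).
Proof.
move=> sym_g; rewrite /prod_lt (bigD1_ord j) //= big_mkcond (bigD1_ord j) //=.
rewrite ltnn mul1r.
have -> : e ^+ j = \prod_(p < m) (if (p < j)%N then e else 1).
  rewrite -big_mkcond prodr_const /=; congr (_ ^+ _).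
  have jm : (j <= m)%N by rewrite -ltnS.
  by rewrite -sum1_card (big_ord_narrow jm) sum1_card card_ord.
rewrite -!big_split /=; apply: eq_bigr => p _.
rewrite [in LHS]big_mkcond [in LHS](bigD1_ord j) //= mulrA; congr (_ * _).
  rewrite (sym_g (lift j p) j) /bump; have [jp|pj] := leqP j p.
    by rewrite add1n ltnS jp ltnNge (leqW jp) mulr1 mul1r.
  by rewrite add0n pj ltnNge (ltnW pj) mul1r.
by rewrite [in RHS]big_mkcond; apply: eq_bigr => q _; rewrite !ltnNge leq_bump2.
Qed.

Lemma prod_lt_recl m (g : 'I_m.+1 -> 'I_m.+1 -> F) :
  prod_lt g = (\prod_k g ord0 (lift ord0 k))
     * prod_lt (fun p q => g (lift ord0 p) (lift ord0 q)).
Proof.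
rewrite /prod_lt big_ord_recl; congr (_ * _).
  by rewrite big_mkcond big_ord_recl /= mul1r.
apply: eq_bigr => i _; rewrite big_mkcond big_ord_recl /= mul1r [RHS]big_mkcond.
by apply: eq_bigr => j _; rewrite /bump !add1n ltnS.
Qed.

Lemma prod_lt_lift2 n (g : 'I_n.+1.*2 -> 'I_n.+1.*2 -> F) e (j : 'I_n.*2.+1) :
    (forall i k, g i k = e * g k i) ->
  prod_lt g = (\prod_k g ord0 (lift ord0 k))
     * (e ^+ j * (\prod_p g (lift ord0 j) (lift2 j p))
        * prod_lt (fun p q => g (lift2 j p) (lift2 j q))).
Proof.
by move=> sym_g; rewrite prod_lt_recl (prod_lt_lift (e := e) j).
Qed.

End ProdLt.

Section Bialternant.

Variable F : fieldType.

(** This is the determinant [W(x, a)] with columns [1, a, x, a x, x^2, ...]. *)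
Definition bialternant n (x a : 'I_n.*2 -> F) : F :=
  \det (\matrix_(i < n.*2, k < n.*2) ((if odd k then a i else 1) * x i ^+ k./2)).

Lemma eq_bialternant n (x x' a a' : 'I_n.*2 -> F) :
  x =1 x' -> a =1 a' -> bialternant x a = bialternant x' a'.
Proof.
by move=> ex ea; congr (\det _); apply/matrixP => i k; rewrite !mxE ex ea.
Qed.

(** The cofactors along row [0] do not see that row, so a single family [c] serves every choice of
    first entries. *)
Lemma bialternant_first_row n (x a : 'I_n.+1.*2 -> F) :
  exists c : 'I_n.+1.*2 -> F, forall x' a' : 'I_n.+1.*2 -> F,
    (forall k, x' (lift ord0 k) = x (lift ord0 k)) ->
    (forall k, a' (lift ord0 k) = a (lift ord0 k)) ->
  bialternant x' a'
  = \sum_(k < n.+1.*2) (if odd k then a' ord0 else 1) * x' ord0 ^+ k./2 * c k.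
Proof.
exists (fun k : 'I_n.+1.*2 => cofactor (\matrix_(i < n.+1.*2, k < n.+1.*2)
          ((if odd k then a i else 1) * x i ^+ k./2)) ord0 k).
move=> x' a' ex ea; rewrite /bialternant (expand_det_row _ ord0).
apply: eq_bigr => k _; rewrite mxE; congr (_ * (_ * \det _)).
by apply/matrixP => i l; rewrite !mxE ex ea.
Qed.

(** When the first two nodes are both [y], subtracting [y] times column [k - 2] from column [k]
    clears the first two rows beyond the first two columns. The matrix is then block lower
    triangular: a [2 x 2] block with rows [1, a], and a smaller bialternant with rows scaled by
    [x - y]. *)
Lemma bialternant_collision0 n (x a : 'I_n.+1.*2 -> F) :
    x (lift ord0 ord0) = x ord0 ->
  bialternant x a = (a (lift ord0 ord0) - a ord0)
     * (\prod_p (x (lift2 ord0 p) - x ord0))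
     * bialternant (fun p => x (lift2 ord0 p)) (fun p => a (lift2 ord0 p)).
Proof.
move=> x01; set y := x ord0.
pose M : 'M[F]_(2 + n.*2) := \matrix_(i < n.+1.*2, k < n.+1.*2)
          ((if odd k then a i else 1) * x i ^+ k./2).
(* Unitriangular matrix of the column operation; [l.+2 == k] selects column [k - 2], which exists
   only for [1 < k]. *)
pose C : 'M[F]_(2 + n.*2) :=
  \matrix_(l, k) ((l == k)%:R - y * (l.+2 == k)%:R).
have detC : \det C = 1.
  rewrite -det_tr det_trig; last first.
    apply/is_trig_mxP => i k ik; rewrite !mxE -val_eqE /=.
    by rewrite [k == i :> nat]gtn_eqF // gtn_eqF ?mulr0 ?subrr // ltnW // ltnW.
  apply: big1 => i _; rewrite !mxE eqxx gtn_eqF // ?mulr0 ?subr0 //.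
have MC i (k : 'I_(2 + n.*2)) : (M *m C) i k
   = M i k - y * (if (1 < k)%N then (if odd k then a i else 1) * x i ^+ (k./2).-1
                  else 0).
  rewrite mxE; under eq_bigr do rewrite [C _ _]mxE mulrBr.
  rewrite sumrB; congr (_ - _).
    rewrite (bigD1 k) //= eqxx mulr1 big1 ?addr0 // => l /negPf ->.
    by rewrite mulr0.
  case: ltnP => k1; last first.
    rewrite mulr0 big1 // => l _; rewrite gtn_eqF ?mulr0 //.
    exact: leq_trans k1 _.
  have k2 : (k.-2 < 2 + n.*2)%N by rewrite (leq_ltn_trans _ (ltn_ord k)) // -subn2 leq_subr.
  rewrite (bigD1 (Ordinal k2)) //= big1 ?addr0 => [|l /negPf lk]; last first.
    rewrite (_ : (l.+2 == k) = false) ?mulr0 //.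
    by apply/eqP => e; move/eqP: lk; apply; apply: val_inj; rewrite /= -e.
  rewrite mxE /=; have -> : (k.-2.+2 == k)%N by case: (k : nat) k1 => [|[]].
  rewrite mulr1 mulrC; case: (k : nat) k1 => [|[|m]] //= _.
  by rewrite negbK.
have -> : bialternant x a = \det (M *m C) by rewrite det_mulmx detC mulr1.
rewrite -[M *m C]submxK.
have -> : ursubmx (M *m C) = 0.
  apply/matrixP => i k; rewrite 2!mxE MC [M _ _]mxE [RHS]mxE /=.
  have -> : x (lshift n.*2 i) = y.
    by rewrite /y; case: i => -[|[|//]] lti; last rewrite -x01; congr x; apply: val_inj.
  by rewrite exprS; ring.
have -> : ulsubmx (M *m C) = \matrix_(i < 2, k < 2) if odd k then a (lshift n.*2 i) else 1.
  apply/matrixP => i k; rewrite [RHS]mxE /ulsubmx /lsubmx 2!mxE MC [M _ _]mxE /=.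
  by case: k => -[|[|//]] ltk /=; rewrite mulr0 subr0 mulr1.
rewrite det_lblock -mulrA; congr (_ * _).
  rewrite (expand_det_row _ ord0) !big_ord_recl big_ord0 /cofactor !det_mx11.
  rewrite !mxE /= expr0 expr1 !mul1r addr0 mulN1r mulrN mulr1.
  by congr (a _ - a _); apply: val_inj.
pose B : 'M[F]_n.*2 := \matrix_(p, k)
  ((if odd k then a (lift2 ord0 p) else 1) * x (lift2 ord0 p) ^+ k./2).
have -> : drsubmx (M *m C) = diag_mx (\row_p (x (lift2 ord0 p) - y)) *m B.
  apply/matrixP => p k; rewrite mul_diag_mx [RHS]mxE /drsubmx /rsubmx 2!mxE MC [M _ _]mxE.
  rewrite !mxE /= negbK (_ : rshift 2 p = lift2 ord0 p); last exact: val_inj.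
  by rewrite !add0n exprS; ring.
rewrite det_mulmx det_diag; congr (_ * _).
by apply: eq_bigr => p _; rewrite mxE.
Qed.

(** Permuting the rows by [matching_lift j 1], of sign [(-1) ^+ j], brings the colliding row next to
    row [0]. *)
Lemma bialternant_collision n (x a : 'I_n.+1.*2 -> F) j :
    x (lift ord0 j) = x ord0 ->
  bialternant x a = (-1) ^+ j * ((a (lift ord0 j) - a ord0)
     * (\prod_p (x (lift2 j p) - x ord0))
     * bialternant (fun p => x (lift2 j p)) (fun p => a (lift2 j p))).
Proof.
move=> x0j; pose s := matching_lift j 1.
have s0 : s ord0 = ord0 by rewrite lift_perm_id.
have s1 : s (lift ord0 ord0) = lift ord0 j by rewrite lift_perm_lift lift_perm_id.
have s2 p : s (lift2 ord0 p) = lift2 j p by rewrite !lift_perm_lift perm1.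
have -> : bialternant x a = (-1) ^+ s * bialternant (x \o s) (a \o s).
  rewrite /bialternant; set B := matrix_of_fun _ _.
  set B' := matrix_of_fun _ _; have -> : B' = perm_mx s *m B.
    by rewrite -row_permE; apply/matrixP => i k; rewrite !mxE.
  by rewrite det_mulmx det_perm mulrA -expr2 sqrr_sign mul1r.
rewrite bialternant_collision0 /= s0 s1 // odd_matching_lift odd_perm1 addbF.
rewrite signr_odd; congr (_ * (_ * _ * _)).
  by apply: eq_bigr => p _; rewrite s2.
by apply: eq_bialternant => p /=; rewrite s2.
Qed.

(** With [a0] frozen only the powers of the first node vary; they run up to [n], since [k./2 <= n]
    for [k < 2 n + 2]. *)
Lemma bialternant_first_poly n (x a : 'I_n.+1.*2 -> F) (a0 : F) :
  exists2 P : {poly F}, (size P <= n.+1)%N &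
    forall x' a' : 'I_n.+1.*2 -> F,
    (forall k, x' (lift ord0 k) = x (lift ord0 k)) ->
    (forall k, a' (lift ord0 k) = a (lift ord0 k)) -> a' ord0 = a0 ->
  bialternant x' a' = P.[x' ord0].
Proof.
have [c cP] := bialternant_first_row x a.
exists (\sum_(k < n.+1.*2) ((if odd k then a0 else 1) * c k) *: 'X^(k./2)).
  apply: (leq_trans (size_sum _ _ _)); apply/bigmax_leqP => k _.
  rewrite (leq_trans (size_scale_leq _ _)) // size_polyXn ltnS -ltnS.
  by rewrite ltn_half_double.
move=> x' a' ex ea ea0; rewrite (cP x' a') // horner_sum; apply: eq_bigr => k _.
by rewrite hornerZ hornerXn ea0 mulrAC.
Qed.

(** Induction on [n]. With [a ord0] and [b ord0] kept fixed, both sides are polynomials of degree at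
    most [2 n] in the first node. They are compared at the other [2 n + 1] nodes, where one term of
    the expanded Pfaffian survives and both bialternants split off a smaller one. *)
Lemma Pf_bialternant n (x a b : 'I_n.*2 -> F) :
    injective x ->
  Pf (\matrix_(i, j) ((a j - a i) * (b j - b i) / (x j - x i)))
    * prod_lt (fun i j => x j - x i)
  = bialternant x a * bialternant x b.
Proof.
elim: n x a b => [|n IHn] x a b x_inj.
  by rewrite Pf0 /bialternant !det_mx00 /prod_lt big_ord0 !mulr1.
have [P sP PE] := bialternant_first_poly x a (a ord0).
have [Q sQ QE] := bialternant_first_poly x b (b ord0).
pose xl j := x (lift ord0 j).
have xl_inj : injective xl by move=> i j /x_inj /lift_inj.
pose G j := (a (lift ord0 j) - a ord0) * (b (lift ord0 j) - b ord0)
  * (\prod_p (x (lift2 j p) - xl j))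
  * (bialternant (fun p => x (lift2 j p)) (fun p => a (lift2 j p))
     * bialternant (fun p => x (lift2 j p)) (fun p => b (lift2 j p))).
(* Left side expanded along the first row, with ['X] for the first node: the factor [x_j - 'X] of
   the product cancels the denominator, and [G] anticipates the induction hypothesis for the
   minor. *)
pose L : {poly F} := \sum_j G j *: \prod_p ((x (lift2 j p))%:P - 'X).
have evalE k y : (\prod_p ((x (lift2 k p))%:P - 'X)).[y]
    = \prod_p (x (lift2 k p) - y).
  by rewrite horner_prod; apply: eq_bigr => p _; rewrite !hornerE.
have LE : L = P * Q.
  apply: (eq_poly_interp xl_inj); rewrite ?card_ord.
  - apply: (leq_trans (size_sum _ _ _)); apply/bigmax_leqP => k _.
    rewrite (leq_trans (size_scale_leq _ _)) //.
    have -> : \prod_p ((x (lift2 k p))%:P - 'X)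
      = \prod_p (- ('X - (x (lift2 k p))%:P)) by apply: eq_bigr => p _; rewrite opprB.
    by rewrite prodrN size_Msign -big_enum size_prod_XsubC -cardE card_ord.
  - rewrite (leq_trans (size_polyMleq _ _)) //.
    by rewrite -ltnS; case: (_ + _)%N (leq_add sP sQ) => //= m; rewrite addnn.
  move=> j; rewrite hornerM horner_sum (bigD1 j) //= [X in _ + X]big1 ?addr0.
    (* The family [x] with its first node moved onto node [j]. *)
    pose x' i := if unlift ord0 i is Some k then x (lift ord0 k) else xl j.
    have x'0 : x' ord0 = xl j by rewrite /x' unlift_none.
    have x'l k : x' (lift ord0 k) = x (lift ord0 k) by rewrite /x' liftK.
    have x'2 p : x' (lift2 j p) = x (lift2 j p) by rewrite x'l.
    rewrite -x'0 -(PE x' a) // -(QE x' b) //.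
    have x'j : x' (lift ord0 j) = x' ord0 by rewrite x'0 x'l.
    rewrite (bialternant_collision a x'j) (bialternant_collision b x'j).
    rewrite mulrACA -expr2 sqrr_sign mul1r x'0.
    rewrite !(eq_bialternant x'2 (frefl _)) hornerZ evalE /G.
    have -> : \prod_p (x' (lift2 j p) - xl j) = \prod_p (x (lift2 j p) - xl j).
      by apply: eq_bigr => p _; rewrite x'2.
    by ring.
  move=> i ij; rewrite hornerZ evalE; apply/eqP; rewrite mulf_eq0.
  have [p ejp _] := unlift_some ij.
  by apply/orP; right; apply/prodf_eq0; exists p; rewrite // /lift2 -ejp subrr.
rewrite (PE x a) // (QE x b) // -hornerM -LE horner_sum Pf_expand big_distrl /=.
apply: eq_bigr => j _.
rewrite (prod_lt_lift2 (e := -1) j) => [|i k]; last by rewrite mulN1r opprB.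
have -> : mxsub (lift2 j) (lift2 j)
      (\matrix_(i, j) ((a j - a i) * (b j - b i) / (x j - x i)))
  = \matrix_(p, q) ((a (lift2 j q) - a (lift2 j p)) * (b (lift2 j q) - b (lift2 j p))
      / (x (lift2 j q) - x (lift2 j p))).
  by apply/matrixP => p q; rewrite !mxE.
have x0j : x (lift ord0 j) - x ord0 != 0.
  by rewrite subr_eq0 (inj_eq x_inj).
have x2_inj : injective (fun p => x (lift2 j p)).
  by move=> p q /x_inj /lift_inj /lift_inj.
rewrite hornerZ evalE /G -(IHn _ _ _ x2_inj) (bigD1_ord j) //= mxE.
set A := \prod_(_ < _) _; set B := \prod_(_ < _) _; set D := prod_lt _.
set S := Pf _; have e2 : (-1) ^+ j * (-1) ^+ j = 1 :> F by rewrite -expr2 sqrr_sign.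
(* The sign of the expansion meets an equal sign from reordering the product. *)
transitivity (((-1) ^+ j * (-1) ^+ j) * S * A * B * D
  * ((a (lift ord0 j) - a ord0) * (b (lift ord0 j) - b ord0))).
  by field.
by rewrite e2; ring.
Qed.

End Bialternant.

(** * Schur Pfaffians *)

Lemma Vandermonde_prod_lt (F : fieldType) m (t : 'I_m -> F) :
  \det (\matrix_(i < m, k < m) t i ^+ k) = prod_lt (fun i j => t j - t i).
Proof.
rewrite -det_tr.
rewrite (_ : _^T = Vandermonde m (\row_i t i)); last first.
  by apply/matrixP => i k; rewrite !mxE.
rewrite det_Vandermonde; apply: eq_bigr => i _; apply: eq_bigr => j _.
by rewrite !mxE.
Qed.

Section Schur.

Variables (F : fieldType).

(** Column [k] is an even power of [t] times [t] or [1], that is [t ^+ k]. *)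
Lemma bialternant_sqr n (t : 'I_n.*2 -> F) :
  bialternant (fun i => t i ^+ 2) t = prod_lt (fun i j => t j - t i).
Proof.
rewrite -Vandermonde_prod_lt; congr (\det _); apply/matrixP => i k; rewrite !mxE.
rewrite -exprM mul2n -{3}(odd_double_half k) exprD.
by case: (odd k); rewrite ?expr1 ?expr0.
Qed.

(** Case [x = t^2], [a = b = t] of [Pf_bialternant]: both bialternants are Vandermonde determinants,
    and one of them cancels. *)
Lemma Pf_Schur n (t : 'I_n.*2 -> F) :
    injective t -> (forall i j, t i + t j != 0) ->
  Pf (\matrix_(i, j) ((t j - t i) / (t j + t i)))
    * prod_lt (fun i j => t j + t i)
  = prod_lt (fun i j => t j - t i).
Proof.
move=> t_inj tD0; pose D := prod_lt (fun i j => t j - t i).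
have D0 : D != 0.
  apply: prod_lt_neq0 => i j ij; rewrite subr_eq0 (inj_eq t_inj).
  by rewrite -val_eqE /= gtn_eqF.
have sqr_inj : injective (fun i => t i ^+ 2).
  move=> i j /eqP; rewrite eqf_sqr => /orP[/eqP/t_inj //|].
  by rewrite -addr_eq0 (negPf (tD0 i j)).
have := Pf_bialternant t t sqr_inj; rewrite bialternant_sqr -/D.
rewrite (_ : prod_lt _ = D * prod_lt (fun i j => t j + t i)); last first.
  by rewrite -prod_ltM; apply: eq_prod_lt => i j _; rewrite subr_sqr.
rewrite (@eq_Pf _ _ _ (\matrix_(i, j) ((t j - t i) / (t j + t i)))).
  by rewrite mulrCA => /(mulfI D0).
move=> i j ij; rewrite !mxE subr_sqr -mulf_div divff ?mul1r // subr_eq0.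
by rewrite (inj_eq t_inj) -val_eqE /= gtn_eqF.
Qed.

(** In the induction step, with [y] for the first variable, the claim is multiplied by a power of
    the product of the [t_k + y] so that both sides become polynomials in [y] of degree at most
    [4 n + 1]. They are compared at the [4 n + 2] points [t_k] and [- t_k]: at [t_k] both vanish, at
    [- t_k] a single summand survives on each side. *)
Lemma Pf_Hf n (t : 'I_n.*2 -> F) :
    [pchar F] =i pred0 ->
    injective t -> (forall i j, t i + t j != 0) ->
  Pf (\matrix_(i, j) ((t j - t i) / (t j + t i) ^+ 2))
    * prod_lt (fun i j => t j + t i)
  = prod_lt (fun i j => t j - t i) * Hf (\matrix_(i, j) (t j + t i)^-1).
Proof.
move=> charF; elim: n t => [|n IHn] t t_inj tD0.
  by rewrite Pf0 Hf0 /prod_lt !big_ord0 !mulr1.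
pose tl (j : 'I_n.*2.+1) := t (lift ord0 j).
have tl_inj : injective tl by move=> i j /t_inj /lift_inj.
pose H j := Hf (\matrix_(p, q) (t (lift2 j q) + t (lift2 j p))^-1).
pose Dm j := prod_lt (fun p q => t (lift2 j q) - t (lift2 j p)).
pose Dp j := prod_lt (fun p q => t (lift2 j q) + t (lift2 j p)).
pose Pfj j := Pf (\matrix_(p, q) ((t (lift2 j q) - t (lift2 j p))
                                 / (t (lift2 j q) + t (lift2 j p)) ^+ 2)).
have Dp0 j : Dp j != 0 by apply: prod_lt_neq0 => p q _; apply: tD0.
have PfjE j : Pfj j * Dp j = Dm j * H j.
  by apply: (IHn (fun p => t (lift2 j p))) => // p q /t_inj /lift_inj /lift_inj.
pose Dm' := prod_lt (fun i j => tl j - tl i).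
pose Dp' := prod_lt (fun i j => tl j + tl i).
have Dp'0 : Dp' != 0 by apply: prod_lt_neq0 => i j _; apply: tD0.
have Dm'E (j : 'I_n.*2.+1) : Dm' = (-1) ^+ j * (\prod_p (t (lift2 j p) - tl j)) * Dm j.
  by rewrite /Dm' (prod_lt_lift (e := -1) j) // => i k; rewrite mulN1r opprB.
have Dp'E (j : 'I_n.*2.+1) : Dp' = (\prod_p (t (lift2 j p) + tl j)) * Dp j.
  rewrite /Dp' (prod_lt_lift (e := 1) j) ?expr1n ?mul1r // => i k.
  by rewrite mul1r addrC.
pose vec y (i : 'I_n.+1.*2) := if unlift ord0 i is Some k then tl k else y.
have vec0 y : vec y ord0 = y by rewrite /vec unlift_none.
have vecl y k : vec y (lift ord0 k) = tl k by rewrite /vec liftK.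
pose A y := \matrix_(i < n.+1.*2, j < n.+1.*2) ((vec y j - vec y i) / (vec y j + vec y i) ^+ 2).
have PfA y : (forall k, tl k + y != 0) ->
    (\prod_k (tl k + y)) ^+ 2 * Pf (A y)
    = \sum_(j < n.*2.+1) (-1) ^+ j * Pfj j * ((tl j - y) * (\prod_p (t (lift2 j p) + y)) ^+ 2).
  move=> yD0; rewrite Pf_expand big_distrr; apply: eq_bigr => j _ /=.
  rewrite (bigD1_ord j) //= mxE vec0 vecl.
  rewrite (_ : Pf (mxsub _ _ _) = Pfj j); last first.
    by congr (Pf _); apply/matrixP => p q; rewrite !mxE !vecl.
  rewrite (_ : \prod_p (t (lift2 j p) + y) = \prod_p (tl (lift j p) + y)) //.
  by field.
pose L : {poly F} := \sum_(j < n.*2.+1) ((-1) ^+ j * Pfj j)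
   *: (((tl j)%:P - 'X) * (\prod_p ((t (lift2 j p))%:P + 'X)) ^+ 2).
(* Right side of the claim, times the product of the [t_k + y] and divided by [Dp'], with the
   Hafnian expanded along the first row: the factor [t_j + y] cancels the matrix entry. *)
pose R : {poly F} := (\prod_k ((tl k)%:P - 'X))
   * \sum_j (Dm' / Dp' * H j) *: \prod_p ((t (lift2 j p))%:P + 'X).
have evalp m (v : 'I_m -> F) y :
    (\prod_p ((v p)%:P + 'X)).[y] = \prod_p (v p + y).
  by rewrite horner_prod; apply: eq_bigr => p _; rewrite !hornerE.
have evalm m (v : 'I_m -> F) y :
    (\prod_p ((v p)%:P - 'X)).[y] = \prod_p (v p - y).
  by rewrite horner_prod; apply: eq_bigr => p _; rewrite !hornerE.
have sizep m (v : 'I_m -> F) : size (\prod_p ((v p)%:P + 'X)) = m.+1.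
  have -> : \prod_p ((v p)%:P + 'X) = \prod_p ('X - (- v p)%:P).
    by apply: eq_bigr => p _; rewrite polyCN opprK addrC.
  by rewrite -big_enum size_prod_XsubC -cardE card_ord.
have sizem m (v : 'I_m -> F) : size (\prod_p ((v p)%:P - 'X)) = m.+1.
  have -> : \prod_p ((v p)%:P - 'X) = \prod_p (- ('X - (v p)%:P)).
    by apply: eq_bigr => p _; rewrite opprB.
  by rewrite prodrN size_Msign -big_enum size_prod_XsubC -cardE card_ord.
have evalL y : L.[y]
    = \sum_(j < n.*2.+1) (-1) ^+ j * Pfj j * ((tl j - y) * (\prod_p (t (lift2 j p) + y)) ^+ 2).
  rewrite horner_sum; apply: eq_bigr => j _.
  by rewrite hornerZ hornerM horner_exp evalp !hornerE.
have evalR y : R.[y]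
    = (\prod_k (tl k - y)) * \sum_j Dm' / Dp' * H j * \prod_p (t (lift2 j p) + y).
  rewrite hornerM evalm horner_sum; congr (_ * _); apply: eq_bigr => j _.
  by rewrite hornerZ evalp.
pose r (i : bool * 'I_n.*2.+1) := if i.1 then tl i.2 else - tl i.2.
have LR : L = R.
  apply: (@eq_poly_interp _ _ r).
  - move=> [[] i] [[] j]; rewrite /r /=.
    + by move=> /tl_inj ->.
    + by move/eqP; rewrite -addr_eq0 (negPf (tD0 _ _)).
    + by move/eqP; rewrite eq_sym -addr_eq0 (negPf (tD0 _ _)).
    + by move=> /oppr_inj /tl_inj ->.
  - rewrite card_prod card_bool card_ord.
    apply: (leq_trans (size_sum _ _ _)); apply/bigmax_leqP => j _.
    rewrite (leq_trans (size_scale_leq _ _)) //.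
    rewrite (leq_trans (size_polyMleq _ _)) //.
    rewrite (_ : size ((tl j)%:P - 'X) = 2%N); last first.
      by rewrite -opprB size_polyN size_XsubC.
    rewrite add2n /= (leq_ltn_trans (size_poly_exp_leq _ _)) //.
    by rewrite sizep /= !mul2n -addnn; lia.
  - rewrite card_prod card_bool card_ord.
    rewrite (leq_trans (size_polyMleq _ _)) // sizem addSn /=.
    rewrite mul2n -[leqRHS]addnn leq_add2l.
    apply: (leq_trans (size_sum _ _ _)); apply/bigmax_leqP => j _.
    by rewrite (leq_trans (size_scale_leq _ _)) // sizep.
  (* At [y = t_j] the rows [0] and [j + 1] of [A y] coincide, and [R] has the factor
     [t_j - y = 0]. *)
  move=> [[] j]; rewrite /r /= evalL evalR.
    rewrite [in RHS](bigD1 j) //= subrr !mul0r -PfA; last by move=> k; apply: tD0.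
    rewrite (@Pf_eq_rows F n.+1 _ ord0 (lift ord0 j)) ?mulr0 // => i; last first.
      by rewrite !mxE vec0 vecl.
    by move=> k; rewrite !mxE -opprB mulNr [vec _ i + _]addrC.
  (* At [y = - t_j] every summand of index other than [j] contains the factor [t_j + y = 0]. *)
  rewrite (bigD1 j) //= [X in _ + X]big1 ?addr0; last first.
    move=> i ij; have [p ejp _] := unlift_some ij.
    rewrite (_ : \prod_p _ = 0) ?expr0n ?mulr0 //; apply/eqP/prodf_eq0.
    by exists p; rewrite // /lift2 -ejp subrr.
  rewrite [X in _ = _ * X](bigD1 j) //= [X in _ = _ * (_ + X)]big1 ?addr0; last first.
    move=> i ij; have [p ejp _] := unlift_some ij.
    rewrite (_ : \prod_p _ = 0) ?mulr0 //; apply/eqP/prodf_eq0.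
    by exists p; rewrite // /lift2 -ejp subrr.
  have -> : \prod_k (tl k - - tl j)
      = (tl j + tl j) * \prod_p (t (lift2 j p) + tl j).
    by rewrite (bigD1_ord j) //= opprK; congr (_ * _); apply: eq_bigr => p; rewrite opprK.
  (* Compares the two surviving terms: [e5] and [e6] split the index [j] off [Dp'] and [Dm'], and
     [e1] is the induction hypothesis. *)
  have alg (u B E z1 z2 z3 z4 z5 z6 c : F) : z3 != 0 -> z5 != 0 -> z5 = E * z3 ->
      z6 = u * B * z2 -> z1 * z3 = z2 * z4 ->
      u * z1 * (c * B ^+ 2) = c * E * (z6 / z5 * z4 * B).
    move=> z30 z50 e5 e6 e1.
    have E0 : E != 0 by apply: contra_neq z50; rewrite e5 => ->; rewrite mul0r.
    have -> : z1 = z2 * z4 / z3 by rewrite -e1 mulfK.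
    by rewrite e5 e6; field; rewrite z30.
  by rewrite opprK; apply: (alg _ _ _ _ _ _ _ _ _ _ (Dp0 j) Dp'0 (Dp'E j) (Dm'E j) (PfjE j)).
have y0 k : tl k + t ord0 != 0 by apply: tD0.
have tE i : t i = vec (t ord0) i.
  by case: (unliftP ord0 i) => [k|] ->; rewrite ?vecl ?vec0.
have := PfA _ y0; rewrite -evalL LR evalR.
rewrite (_ : A _ = \matrix_(i, j) ((t j - t i) / (t j + t i) ^+ 2)); last first.
  by apply/matrixP => i j; rewrite !mxE -!tE.
rewrite (prod_lt_recl (fun i j => t j + t i)) (prod_lt_recl (fun i j => t j - t i)).
rewrite -/Dp' -/Dm' Hf_expand.
have P0 : \prod_k (tl k + t ord0) != 0 by apply/prodf_neq0 => k _.
have -> : \sum_(j < n.*2.+1) Dm' / Dp' * H j * \prod_p (t (lift2 j p) + t ord0)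
  = Dm' / Dp' * \prod_k (tl k + t ord0)
    * \sum_(j < n.*2.+1) (\matrix_(i, j) (t j + t i)^-1) ord0 (lift ord0 j)
                          * Hf (mxsub (lift2 j) (lift2 j)
                              (\matrix_(i, j) (t j + t i)^-1)).
  rewrite big_distrr; apply: eq_bigr => j _ /=; rewrite mxE (bigD1_ord j) //=.
  rewrite (_ : Hf (mxsub _ _ _) = H j); last first.
    by congr (Hf _); apply/matrixP => p q; rewrite !mxE.
  rewrite (_ : \prod_p (t (lift2 j p) + t ord0)
             = \prod_p (tl (lift j p) + t ord0)) // -/(tl j).
  by field; rewrite Dp'0 y0.
set S := \sum_(j < _) _; set z := Pf _; move=> e.
apply: (mulfI P0); transitivity ((\prod_k (tl k + t ord0)) ^+ 2 * z * Dp').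
  by rewrite [LHS]mulrCA; ring.
by rewrite e; field.
Qed.

End Schur.

(** * Characters as bialternants *)

Section PolyComb.

Variables (F : fieldType) (I : Type) (w : nat -> I -> F).

(* The linear form sending ['X^l] to [w l i]. *)
Definition poly_comb (p : {poly F}) (i : I) : F := \sum_(l < size p) p`_l * w l i.

Lemma poly_combE N (p : {poly F}) i : (size p <= N)%N -> poly_comb p i = \sum_(l < N) p`_l * w l i.
Proof.
move=> leN; rewrite /poly_comb (big_ord_widen N (fun l => p`_l * w l i) leN).
rewrite big_mkcond; apply: eq_bigr => l _; case: ltnP => // lel.
by rewrite nth_default ?mul0r.
Qed.

Lemma poly_combD p q i : poly_comb (p + q) i = poly_comb p i + poly_comb q i.
Proof.
have lep := leq_maxl (size p) (size q); have leq := leq_maxr (size p) (size q).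
rewrite (poly_combE _ (size_polyD p q)) (poly_combE _ lep) (poly_combE _ leq).
by rewrite -big_split; apply: eq_bigr => l _ /=; rewrite coefD mulrDl.
Qed.

Lemma poly_combZ c p i : poly_comb (c *: p) i = c * poly_comb p i.
Proof.
rewrite (poly_combE _ (size_scale_leq c p)) /poly_comb big_distrr.
by apply: eq_bigr => l _; rewrite /= coefZ mulrA.
Qed.

Lemma poly_combXn k i : poly_comb 'X^k i = w k i.
Proof.
rewrite /poly_comb size_polyXn big_ord_recr /= coefXn eqxx mul1r big1 ?add0r //.
by move=> l _; rewrite coefXn ltn_eqF ?mul0r.
Qed.

Lemma poly_combXnM d c (p : {poly F}) i : (forall l, w (l + d)%N i = c * w l i) ->
  poly_comb ('X^d * p) i = c * poly_comb p i.
Proof.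
move=> wd; have le : (size ('X^d * p)%R <= d + size p)%N.
  by rewrite (leq_trans (size_polyMleq _ _)) // size_polyXn.
rewrite (poly_combE _ le) big_split_ord /= big1 ?add0r => [|l _]; last first.
  by rewrite coefXnM ltn_ord mul0r.
rewrite big_distrr; apply: eq_bigr => l _ /=.
by rewrite coefXnM ltnNge leq_addr addKn /= addnC wd mulrCA.
Qed.

(** The polynomial [u] stores the coefficients of [g] in the family [w]: monic of degree [k] means
    [w k] plus earlier members, and a shift of indices becomes multiplication by a power of ['X]. *)
Definition monic_comb k (g : I -> F) := exists u : {poly F},
  [/\ u \is monic, size u = k.+1 & forall i, g i = poly_comb u i].

Lemma monic_combXn k g : (forall i, g i = w k i) -> monic_comb k g.
Proof.
move=> gE; exists 'X^k; split; rewrite ?monicXn ?size_polyXn // => i.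
by rewrite gE poly_combXn.
Qed.

Lemma monic_combXnM d c k g h : (forall l i, w (l + d)%N i = c i * w l i) ->
  (forall i, h i = c i * g i) -> monic_comb k g -> monic_comb (k + d) h.
Proof.
move=> wd hE [u [mon_u size_u uE]]; exists ('X^d * u); split.
- by rewrite monicMl ?monicXn.
- rewrite size_monicM ?monicXn ?monic_neq0 // size_polyXn size_u.
  by rewrite addnS /= addSn addnC.
- by move=> i; rewrite hE uE (poly_combXnM _ (fun l => wd l i)).
Qed.

Lemma monic_combD k k' c g g' h : (k' < k)%N -> (forall i, h i = g i + c * g' i) ->
  monic_comb k g -> monic_comb k' g' -> monic_comb k h.
Proof.
move=> lt hE [u [mon_u su uE]] [u' [_ su' uE']].
have ltu : (size (c *: u') < size u)%N.
  by rewrite su ltnS (leq_trans (size_scale_leq _ _)) // su'.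
exists (u + c *: u'); split.
- by rewrite monicE lead_coefDl // -monicE.
- by rewrite size_polyDl.
- by move=> i; rewrite hE uE uE' poly_combD poly_combZ.
Qed.

End PolyComb.

(** The coefficients of the monic polynomials form a unitriangular transition matrix. *)
Lemma det_monic_comb (F : fieldType) N (w E : nat -> 'I_N -> F) :
    (forall k, monic_comb w k (E k)) ->
  \det (\matrix_(i < N, k < N) E k i) = \det (\matrix_(i < N, k < N) w k i).
Proof.
move=> /(fun h (k : 'I_N) => h k) /fin_all_exists[u uP].
pose U : 'M[F]_N := \matrix_(l, k) (u k)`_l.
have -> : (\matrix_(i < N, k < N) E k i) = (\matrix_(i < N, k < N) w k i) *m U.
  apply/matrixP => i k; have [_ size_u uE] := uP k.
  rewrite !mxE uE (@poly_combE _ _ _ N) ?size_u //.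
  by apply: eq_bigr => l _; rewrite !mxE mulrC.
rewrite det_mulmx -[\det U]det_tr [\det U^T]det_trig.
  rewrite big1 ?mulr1 // => k _; rewrite !mxE.
  by have [/monicP] := uP k; rewrite /lead_coef => + size_u; rewrite size_u.
apply/is_trig_mxP => k l kl; rewrite !mxE nth_default //.
by have [_ -> _] := uP k.
Qed.

Section Alternants.

Variables (F : fieldType) (N : nat) (y : 'I_N -> F) (f : nat -> nat) (d : nat).
Hypothesis y0 : forall i, y i != 0.

Let E k i := y i ^+ f k - y i ^- f k.
Let tau i := y i ^+ d + y i ^- d.

Lemma alternant_shift e i :
  y i ^+ (e + d + d) - y i ^- (e + d + d)
  = tau i * (y i ^+ (e + d) - y i ^- (e + d)) - (y i ^+ e - y i ^- e).
Proof.
have yX m : y i ^+ m != 0 by rewrite expf_neq0.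
by rewrite /tau !exprD; field; rewrite !yX.
Qed.

(** Exponents in arithmetic progression: by the recurrence [alternant_shift], [E k] is [E 0] times a
    monic polynomial of degree [k] in [tau], which leaves a Vandermonde determinant. The cases
    [d = 1], [c = 0] and [d = 2], [c = 1] give the denominators of the two characters. *)
Lemma det_alternant1 (c : F) :
    (forall k, f k.+1 = f k + d)%N -> (forall i, E 1%N i = (tau i + c) * E 0%N i) ->
  \det (\matrix_(i < N, k < N) (y i ^+ f k - y i ^- f k))
  = (\prod_i (y i ^+ f 0%N - y i ^- f 0%N)) * prod_lt (fun i j => tau j - tau i).
Proof.
move=> fS E1; rewrite -Vandermonde_prod_lt.
transitivity (\det (\matrix_(i < N, k < N) (tau i ^+ k * E 0%N i))).
  apply: (@det_monic_comb _ _ (fun k i => tau i ^+ k * E 0%N i) E) => k.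
  suff: monic_comb (fun k i => tau i ^+ k * E 0%N i) k (E k) /\
        monic_comb (fun k i => tau i ^+ k * E 0%N i) k.+1 (E k.+1) by case.
  have E0 : monic_comb (fun k i => tau i ^+ k * E 0%N i) 0 (E 0%N).
    by apply: monic_combXn => i; rewrite expr0 mul1r.
  elim: k => [|k [IH0 IH1]]; split => //.
    apply: (monic_combD (k' := 0) (c := c) (g := fun i => tau i * E 0%N i)) (E0) => //.
      by move=> i; rewrite E1 mulrDl.
    by apply: (monic_combXnM (k := 0) (c := tau) _ _ E0) => // l i; rewrite addn1 exprS mulrA.
  apply: (monic_combD (k' := k) (c := -1) (g := fun i => tau i * E k.+1 i)) (IH0) => //.
    by move=> i; rewrite /E !fS alternant_shift mulN1r.
  rewrite -addn1; apply: (monic_combXnM (c := tau) _ _ IH1) => // l i.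
  by rewrite addn1 exprS mulrA.
rewrite (_ : \matrix_(i, k) (tau i ^+ k * E 0%N i)
  = diag_mx (\row_i E 0%N i) *m \matrix_(i, k) tau i ^+ k); last first.
  by apply/matrixP => i k; rewrite mul_diag_mx !mxE mulrC.
rewrite det_mulmx det_diag; congr (_ * _).
by apply: eq_bigr => i _; rewrite mxE.
Qed.

(** Two interleaved progressions of step [d]. They start with [E 2 = tau * E 0 + E 1] and
    [E 3 = tau * E 1 + E 0], because [d - f 0 = f 1]; then [E (k + 4) = tau * E (k + 2) - E k]. *)
Lemma det_alternant2 :
    (forall k, f k.+2 = f k + d)%N -> (f 0 + f 1 = d)%N ->
  \det (\matrix_(i < N, k < N) (y i ^+ f k - y i ^- f k))
  = \det (\matrix_(i < N, k < N)
            ((if odd k then E 1%N i else E 0%N i) * tau i ^+ k./2)).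
Proof.
move=> fSS f01; pose w k i := (if odd k then E 1%N i else E 0%N i) * tau i ^+ k./2.
have wSS l i : w (l + 2)%N i = tau i * w l i.
  by rewrite /w addn2 /= negbK exprS mulrCA.
apply: (@det_monic_comb _ _ w E) => k.
(* The recurrence reaches back four indices, so four consecutive ones are carried through the
   induction. *)
suff: [/\ monic_comb w k (E k), monic_comb w k.+1 (E k.+1),
          monic_comb w k.+2 (E k.+2) & monic_comb w k.+3 (E k.+3)] by case.
have yX i m : y i ^+ m != 0 by rewrite expf_neq0.
have E0 : monic_comb w 0 (E 0%N) by apply: monic_combXn => i; rewrite /w mulr1.
have E1 : monic_comb w 1 (E 1%N) by apply: monic_combXn => i; rewrite /w mulr1.
elim: k => [|k [IH0 IH1 IH2 IH3]]; split => //.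
- apply: (monic_combD (k' := 1) (c := 1) (g := fun i => tau i * E 0%N i)) (E1) => //.
    by move=> i; rewrite /E fSS /tau -f01 !exprD; field; rewrite !yX.
  exact: (monic_combXnM (k := 0) (c := tau) wSS _ E0).
- apply: (monic_combD (k' := 0) (c := 1) (g := fun i => tau i * E 1%N i)) (E0) => //.
    by move=> i; rewrite /E fSS /tau -f01 !exprD; field; rewrite !yX.
  exact: (monic_combXnM (k := 1) (c := tau) wSS _ E1).
- apply: (monic_combD (k' := k) (c := -1) (g := fun i => tau i * E k.+2 i)) (IH0).
  + by rewrite -addn4 -[X in (X < _)%N]addn0 ltn_add2l.
  + by move=> i; rewrite /E !fSS alternant_shift mulN1r.
  rewrite (_ : k.+4 = k.+2 + 2)%N; last by rewrite addn2.
  exact: (monic_combXnM (c := tau) wSS _ IH2).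
Qed.

End Alternants.

(** The characters list exponents in decreasing order, the determinants above in increasing order;
    reversing the columns multiplies both alternants by the same sign. *)
Lemma det_rev_ratio (F : fieldType) N (g h : 'I_N -> 'I_N -> F) :
  \det (\matrix_(i, j) g i j) / \det (\matrix_(i, j) h i j)
  = \det (\matrix_(i, j) g i (rev_ord j)) / \det (\matrix_(i, j) h i (rev_ord j)).
Proof.
pose s := perm (@rev_ord_inj N).
have revE (f : 'I_N -> 'I_N -> F) :
    \det (\matrix_(i, j) f i (rev_ord j)) = \det (\matrix_(i, j) f i j) * (-1) ^+ s.
  rewrite -odd_permV -det_perm -det_mulmx -col_permE; congr (\det _).
  by apply/matrixP => i j; rewrite !mxE permE.
by rewrite !revE -mulf_div divff ?mulr1 // signr_eq0.
Qed.

Lemma rev_iotaS m : rev (iota 0 m.+2) = m.+1 :: rev (iota 0 m.+1).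
Proof. by rewrite -[m.+2]addn1 iotaD rev_cat. Qed.

Lemma geq_trans : transitive geq.
Proof. by move=> p m q mp qm; apply: leq_trans qm mp. Qed.

Lemma geq_anti : antisymmetric geq.
Proof. by move=> m p; rewrite andbC => /anti_leq. Qed.

Lemma sort_geq_eq (s t : seq nat) : sorted geq t -> perm_eq s t -> sort geq s = t.
Proof.
move=> sorted_t st; apply: (sorted_eq geq_trans geq_anti) => //.
  by apply: sort_sorted => i j; rewrite /geq /= leq_total.
by rewrite perm_sort.
Qed.

Lemma delta_predE m : delta (m.+1%:Z - 1) = rev (iota 0 m.+1).
Proof. by rewrite (_ : m.+1%:Z - 1 = m%:Z) // -addn1 PoszD addrK. Qed.

(** The partition [(m, m, m - 1, m - 1, ..., 0, 0)], a closed form of [delta2] with both indices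
    [m]. *)
Definition staircase m := mkseq (fun j => m - j./2)%N m.+1.*2.

Lemma staircaseS m : staircase m.+1 = [:: m.+1, m.+1 & staircase m].
Proof.
rewrite /staircase /mkseq.
rewrite (_ : iota 0 m.+2.*2 = [:: 0%N, 1%N & iota 2 m.+1.*2]) // 2!map_cons.
by rewrite (iotaDl 2 0) -map_comp; congr [:: _, _ & _]; apply: eq_map.
Qed.

Lemma sorted_staircase m : path geq m (staircase m).
Proof.
elim: m => [|m IHm] //; rewrite staircaseS.
case: (staircase m) IHm => [|x s] /=; rewrite !leqnn //= => /andP[le ->].
by rewrite andbT (leq_trans le).
Qed.

Lemma perm_staircase m : perm_eq (rev (iota 0 m.+1) ++ rev (iota 0 m.+1)) (staircase m).
Proof.
elim: m => [|m IHm] //; rewrite staircaseS rev_iotaS cat_cons perm_cons.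
by rewrite -cat1s perm_catCA perm_cons.
Qed.

Lemma delta2_pred_pred m : delta2 (m.+1%:Z - 1) (m.+1%:Z - 1) = staircase m.
Proof.
rewrite /delta2 delta_predE; apply: sort_geq_eq (perm_staircase m).
exact: path_sorted (sorted_staircase m).
Qed.

(** The list has [2 m + 3] entries; in [2 m + 2] variables the character truncates it before its
    last [0]. *)
Lemma delta2_pred m : delta2 m.+1%:Z (m.+1%:Z - 1) = m.+1 :: staircase m.
Proof.
rewrite /delta2 delta_predE /delta rev_iotaS; apply: sort_geq_eq.
  by have := sorted_staircase m.+1; rewrite staircaseS => /andP[_ /andP[_]].
by rewrite cat_cons perm_cons perm_staircase.
Qed.

Lemma nth_staircase m j : (j < m.+1.*2)%N -> nth 0%N (staircase m) j = (m - j./2)%N.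
Proof. by move=> lt; rewrite nth_mkseq. Qed.

(** Read backwards, the exponents are [1, 2, 4, 5, 7, ...], the integers prime to [3], so
    [det_alternant2] applies with [d = 3]. Each row yields the factor [z - z^-1], common to both
    alternants, and [z^2 - z^-2] divided by it is [z + z^-1]. *)
Lemma Sp_char_bialternant (F : fieldType) n (z : 'I_n.*2 -> F) :
    (0 < n)%N -> (forall i, z i != 0) -> (forall i, z i - (z i)^-1 != 0) ->
  Sp_char (delta2 (n%:Z - 1) (n%:Z - 1)) z
  = bialternant (fun i => z i ^+ 3 + z i ^- 3) (fun i => z i + (z i)^-1)
    / prod_lt (fun i j => (z j + (z j)^-1) - (z i + (z i)^-1)).
Proof.
case: n z => // m z _ z0 s0; rewrite /Sp_char delta2_pred_pred.
rewrite det_rev_ratio.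
have zX i k : z i ^+ k != 0 by rewrite expf_neq0.
pose r := \prod_i (z i - (z i)^-1).
have r0 : r != 0 by apply/prodf_neq0.
rewrite (_ : \det _ = r * bialternant (fun i => z i ^+ 3 + z i ^- 3) (fun i => z i + (z i)^-1)).
  rewrite [in X in _ / X](_ : \det _
    = r * prod_lt (fun i j => (z j + (z j)^-1) - (z i + (z i)^-1))).
    by rewrite -mulf_div divff // mul1r.
  transitivity (\det (\matrix_(i < m.+1.*2, k < m.+1.*2) (z i ^+ k.+1 - z i ^- k.+1))).
    congr (\det _); apply/matrixP => i j; rewrite !mxE nth_nil /= add0n.
    by rewrite (_ : (_ - _)%N = j.+1) //; have := ltn_ord j; lia.
  apply: (@det_alternant1 _ _ z succn 1 z0 0) => [k|i]; first by rewrite addn1.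
  by rewrite addr0 !expr1; field.
transitivity (\det (\matrix_(i < m.+1.*2, k < m.+1.*2)
   (z i ^+ (k + k./2).+1 - z i ^- (k + k./2).+1))).
  congr (\det _); apply/matrixP => i j; rewrite !mxE nth_staircase.
    rewrite (_ : (_ + _)%N = (j + j./2).+1)%N //; have /= := ltn_ord j; lia.
  have /= := ltn_ord j; lia.
rewrite (@det_alternant2 _ _ z (fun k => (k + k./2).+1) 3 z0) //=; last first.
  by move=> k; lia.
rewrite (_ : matrix_of_fun _ _ = diag_mx (\row_i (z i - (z i)^-1)) *m
   \matrix_(i, k) ((if odd k then z i + (z i)^-1 else 1)
         * (z i ^+ 3 + z i ^- 3) ^+ k./2)).
  rewrite det_mulmx det_diag; congr (_ * _).
  by apply: eq_bigr => i _; rewrite mxE.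
apply/matrixP => i k; rewrite mul_diag_mx !mxE mulrA; congr (_ * _).
by case: (odd k); rewrite ?mulr1 //; field.
Qed.

(** Read backwards, the exponents of [x] are [1, 5, 7, 11, ...], the integers prime to [6], so
    [det_alternant2] applies with [d = 6]; [t^2 + t - 1] is the quotient of [x^5 - x^-5] by
    [x - x^-1]. *)
Lemma tildeO_char_bialternant (F : fieldType) n (x : 'I_n.*2 -> F) :
    (0 < n)%N -> (forall i, x i != 0) -> (forall i, x i - (x i)^-1 != 0) ->
  let t i := x i ^+ 2 + x i ^- 2 in
  tildeO_char (delta2 n%:Z (n%:Z - 1)) x
  = bialternant (fun i => x i ^+ 6 + x i ^- 6) (fun i => t i ^+ 2 + t i - 1)
    / prod_lt (fun i j => t j - t i).
Proof.
case: n x => // m x _ x0 s0 t; rewrite /tildeO_char delta2_pred.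
rewrite det_rev_ratio.
have xX i k : x i ^+ k != 0 by rewrite expf_neq0.
pose r := \prod_i (x i - (x i)^-1).
have r0 : r != 0 by apply/prodf_neq0.
rewrite (_ : \det _ = r * bialternant (fun i => x i ^+ 6 + x i ^- 6) (fun i => t i ^+ 2 + t i - 1)).
  rewrite [in X in _ / X](_ : \det _ = r * prod_lt (fun i j => t j - t i)).
    by rewrite -mulf_div divff // mul1r.
  transitivity (\det (\matrix_(i < m.+1.*2, k < m.+1.*2)
                        (x i ^+ k.*2.+1 - x i ^- k.*2.+1))).
    congr (\det _); apply/matrixP => i j; rewrite !mxE nth_nil /= add0n.
    by rewrite (_ : (_ - 1)%N = j.*2.+1) //; have /= := ltn_ord j; lia.
  apply: (@det_alternant1 _ _ x (fun k => k.*2.+1) 2 x0 1) => [k|i]; first lia.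
  by rewrite !expr1; field.
transitivity (\det (\matrix_(i < m.+1.*2, k < m.+1.*2)
   (x i ^+ (k + uphalf k).*2.+1 - x i ^- (k + uphalf k).*2.+1))).
  congr (\det _); apply/matrixP => i j; rewrite !mxE.
  (* Backwards, the truncated partition reads [0, 1, 1, 2, 2, ...]. *)
  have -> : nth 0%N (m.+1 :: staircase m) (rev_ord j) = uphalf j.
    have := ltn_ord j; case e : (rev_ord j : nat) => [|k] /= ltj.
      by move: e => /=; lia.
    by rewrite nth_staircase; move: e => /=; lia.
  rewrite (_ : (_ - 1)%N = (j + uphalf j).*2.+1)%N //; have /= := ltn_ord j; lia.
rewrite (@det_alternant2 _ _ x (fun k => (k + uphalf k).*2.+1) 6 x0) //=; last first.
  by move=> k; lia.
rewrite (_ : matrix_of_fun _ _ = diag_mx (\row_i (x i - (x i)^-1)) *m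
   \matrix_(i, k) ((if odd k then t i ^+ 2 + t i - 1 else 1)
         * (x i ^+ 6 + x i ^- 6) ^+ k./2)).
  rewrite det_mulmx det_diag; congr (_ * _).
  by apply: eq_bigr => i _; rewrite mxE.
apply/matrixP => i k; rewrite mul_diag_mx !mxE mulrA; congr (_ * _).
by case: (odd k); rewrite ?mulr1 // /t; field.
Qed.

(** * Reduction to the variables t *)

Section Entries.

Variable F : fieldType.
Implicit Types a c x y u v : F.

Definition trace2 x := x ^+ 2 + x ^- 2.

(* [(al - y^2 - y^-2) (al - z^2 - z^-2)] for [y = x1 x2], [z = x1 / x2],
   written in terms of [u = trace2 x1] and [v = trace2 x2]. *)
Definition quad al u v := al ^+ 2 - al * u * v + u ^+ 2 + v ^+ 2 - 4.

Lemma sigma_mul_div x y : x != 0 -> y != 0 ->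
  sigma (y / x) * sigma (x * y) = trace2 y - trace2 x.
Proof. by move=> x0 y0; rewrite /sigma /trace2; field; rewrite x0 y0. Qed.

Lemma quadE a x y : a != 0 -> x != 0 -> y != 0 ->
  sigma (a * x / y) * sigma (a * y / x) * sigma (a * x * y) * sigma (a / (x * y))
  = quad (trace2 a) (trace2 x) (trace2 y).
Proof. by move=> a0 x0 y0; rewrite /sigma /trace2 /quad; field; rewrite a0 x0 y0. Qed.

(** The difference of reciprocals has numerator [P - Q], which does not depend on [a], and
    denominator [P * Q], which is [quad]. *)
Lemma M1_entry a x y : a != 0 -> x != 0 -> y != 0 ->
    quad (trace2 a) (trace2 x) (trace2 y) != 0 ->
  sigma (y / x) * sigma (x * y)
    * ((sigma (a * x * y) * sigma (a / (x * y)))^-1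
       - (sigma (a * y / x) * sigma (a * x / y))^-1)
  = sigma (x ^+ 2) * sigma (y ^+ 2)
    * ((trace2 y - trace2 x) / quad (trace2 a) (trace2 x) (trace2 y)).
Proof.
move=> a0 x0 y0; rewrite sigma_mul_div // -quadE //.
rewrite -[X in X != 0]mulrA mulf_eq0 negb_or.
set P := sigma (a * x / y) * _; set Q := sigma (a * x * y) * _ => /andP[P0 Q0].
have QP : P - Q = sigma (x ^+ 2) * sigma (y ^+ 2).
  by rewrite /P /Q /sigma; field; rewrite a0 x0 y0.
rewrite [sigma (a * y / x) * _]mulrC -/P -[P * sigma _ * _]mulrA -/Q -QP.
by field; rewrite P0 Q0.
Qed.

(** For [c^2 = -1], [sigma (c * z) = c (z + z^-1)] is invariant under inversion of [z], so the four
    numerators coincide and a signed sum of four reciprocals remains. *)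
Lemma M2_entry a c x y : c ^+ 2 = -1 -> a != 0 -> x != 0 -> y != 0 ->
    quad (trace2 a) (trace2 x) (trace2 y) != 0 ->
  sigma (y / x) * sigma (x * y)
     * (sigma (c * x) * sigma (c * y) / sigma (a * x * y)
        - sigma (c * x) * sigma (c / y) / sigma (a * x / y)
        - sigma (c / x) * sigma (c * y) / sigma (a * y / x)
        + sigma (c / x) * sigma (c / y) / sigma (a / (x * y)))
  = - sigma a * (sigma (x ^+ 2) * sigma (y ^+ 2))
    * ((trace2 y - trace2 x) * (trace2 a + 2 + trace2 x + trace2 y)
       / quad (trace2 a) (trace2 x) (trace2 y)).
Proof.
move=> c2 a0 x0 y0; rewrite sigma_mul_div // -quadE // !mulf_eq0 !negb_or.
have cV : c^-1 = - c.
  have c0 : c != 0 by apply: contra_eq_neq c2 => ->; rewrite expr0n eq_sym oppr_eq0 oner_eq0.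
  by apply: (mulfI c0); rewrite mulfV // mulrN -expr2 c2 opprK.
have sc z : z != 0 -> sigma (c * z) = c * (z + z^-1).
  by move=> z0; rewrite /sigma invfM cV; ring.
rewrite !sc ?invr_neq0 // !invrK.
set S2 := sigma (a * x / y); set S3 := sigma (a * y / x).
set S1 := sigma (a * x * y); set S4 := sigma (a / (x * y)).
move=> /andP[/andP[/andP[S20 S30] S10] S40].
have e : (S1 + S4) * (S2 * S3) - (S2 + S3) * (S1 * S4)
  = sigma a * (sigma x * sigma y) * (trace2 a + 2 + trace2 x + trace2 y).
  by rewrite /S1 /S2 /S3 /S4 /sigma /trace2; field; rewrite a0 x0 y0.
have sx z : z != 0 -> sigma (z ^+ 2) = (z + z^-1) * sigma z.
  by move=> z0; rewrite /sigma; field.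
rewrite !sx //.
transitivity ((trace2 y - trace2 x) * c ^+ 2 * ((x + x^-1) * (y + y^-1))
  * (((S1 + S4) * (S2 * S3) - (S2 + S3) * (S1 * S4)) / (S2 * S3 * S1 * S4))).
  by field; rewrite S10 S20 S30 S40 x0 y0.
by rewrite e c2; field; rewrite S10 S20 S30 S40 x0 y0.
Qed.

End Entries.

Section Reduction.

Variables (F : fieldType) (n : nat) (x : 'I_n.*2 -> F) (a : F).
Hypotheses (x0 : forall i, x i != 0) (a0 : a != 0).
Hypothesis sigma_x0 : forall i, sigma (x i ^+ 2) != 0.

Let t i := trace2 (x i).
Let q i j := quad (trace2 a) (t i) (t j).

Hypothesis q0 : forall i j : 'I_n.*2, (i < j)%N -> q i j != 0.

(** The diagonal factors [sigma (x i ^+ 2)] of the denominator are split off; they will cancel the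
    scaling factors of the matrix entries. *)
Lemma F_UO_E : F_UO x a * \prod_i sigma (x i ^+ 2)
  = prod_lt q / prod_lt (fun i j => t j - t i).
Proof.
have s0 : \prod_i sigma (x i ^+ 2) != 0 by apply/prodf_neq0.
rewrite /F_UO.
have -> : \prod_(i < n.*2) \prod_(j < n.*2 | (i <= j)%N) sigma (x i * x j)
  = (\prod_i sigma (x i ^+ 2)) * prod_lt (fun i j => sigma (x i * x j)).
  rewrite /prod_lt -big_split; apply: eq_bigr => i _ /=.
  rewrite (bigD1 i) //= -expr2; congr (_ * _); apply: eq_bigl => j.
  by rewrite andbC -val_eqE ltn_neqAle eq_sym.
rewrite -/(prod_lt (fun i j => sigma (x j / x i))) mulrCA -prod_ltM.
rewrite -/(prod_lt (fun i j => sigma (a * x i / x j) * sigma (a * x j / x i)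
      * sigma (a * x i * x j) * sigma (a / (x i * x j)))).
rewrite (@eq_prod_lt _ _ _ q) => [|i j _]; last by rewrite quadE.
rewrite (@eq_prod_lt _ _ (fun i j => sigma (x j / x i) * _) (fun i j => t j - t i)).
  by rewrite [X in _ / X]mulrC invfM -!mulrA mulVf // mulr1.
by move=> i j _; rewrite sigma_mul_div.
Qed.

Lemma A1_reduction : A1_UO x a
  = sigma a ^ (- (4 * n ^ 2)%:Z + (4 * n)%:Z)
    * (prod_lt q / prod_lt (fun i j => t j - t i))
    * Pf (\matrix_(i, j) ((t j - t i) / q i j)).
Proof.
rewrite /A1_UO -F_UO_E.
have -> : Pf (M1_UO x a) = 1 ^+ n * (\prod_i sigma (x i ^+ 2))
    * Pf (\matrix_(i, j) ((t j - t i) / q i j)).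
  rewrite -Pf_scale; apply: eq_Pf => i j ij.
  by rewrite !mxE mul1r M1_entry ?q0.
by rewrite expr1n mul1r -!mulrA.
Qed.

(** Both [sigma (c / a)] and [sigma (a ^+ 2)] contain [a + a^-1], whose powers cancel, so the right
    side has no such factor left to vanish at [zeta_4]. The sign [(-1) ^+ n] from the entries
    cancels [c ^+ (2 * n)]. *)
Lemma A2_reduction c : c ^+ 2 = -1 -> sigma a != 0 -> a + a^-1 != 0 ->
  A2_UO x a c
  = sigma a ^ (- (4 * n ^ 2)%:Z + (4 * n)%:Z)
    * (prod_lt q / prod_lt (fun i j => t j - t i))
    * Pf (\matrix_(i, j) ((t j - t i) * (trace2 a + 2 + t i + t j) / q i j)).
Proof.
move=> c2 sa0 aD0; rewrite /A2_UO -F_UO_E.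
have c0 : c != 0 by apply: contra_eq_neq c2 => ->; rewrite expr0n eq_sym oppr_eq0 oner_eq0.
have -> : Pf (M2_UO x a c) = (- sigma a) ^+ n * (\prod_i sigma (x i ^+ 2))
    * Pf (\matrix_(i, j) ((t j - t i) * (trace2 a + 2 + t i + t j) / q i j)).
  rewrite -Pf_scale; apply: eq_Pf => i j ij.
  by rewrite !mxE M2_entry ?q0.
have -> : sigma (c / a) = c * (a + a^-1).
  rewrite /sigma; transitivity (c * a^-1 + c ^+ 2 * (a / c)).
    by rewrite c2; field; rewrite a0 c0.
  by field; rewrite a0 c0.
have -> : sigma (a ^+ 2) = sigma a * (a + a^-1) by rewrite /sigma; field.
set S := \prod_i _; set P := Pf _.
have -> : sigma a ^ (- (4 * n ^ 2)%:Z + (4 * n)%:Z)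
  = sigma a ^ (- (4 * n ^ 2)%:Z + n%:Z) * sigma a ^+ n * sigma a ^+ (2 * n).
  rewrite !exprnP -!expfzDr //; congr (_ ^ _); lia.
rewrite -exprnN !exprMn [(- sigma a) ^+ n]exprNn.
have cn : (-1) ^+ n = (c ^+ (2 * n)) :> F by rewrite exprM c2.
rewrite cn; set e := sigma a ^ _; set s := sigma a ^+ n.
have := expf_neq0 (2 * n) c0; have := expf_neq0 (2 * n) aD0.
set cc := c ^+ _; set b := _ ^+ (2 * n); set f := sigma a ^+ _ => b0 cc0.
by field; rewrite b0 cc0.
Qed.

End Reduction.

(** Each [d i] occurs in [m - 1] pairs; the extra product on the left avoids the truncated
    subtraction. *)
Lemma prod_lt_sym (F : fieldType) m (d : 'I_m -> F) :
  prod_lt (fun i j => d i * d j) * \prod_i d i = (\prod_i d i) ^+ m.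
Proof.
elim: m d => [|m IHm] d; first by rewrite /prod_lt !big_ord0 mulr1.
rewrite prod_lt_recl big_split prodr_const card_ord /= !big_ord_recl.
have /= e := IHm (fun p => d (lift ord0 p)).
by rewrite exprS exprMn -e; ring.
Qed.

(** * Evaluation at the fourth and sixth roots of unity *)

Section Specialisations.

Variables (F : fieldType) (n : nat) (x : 'I_n.*2 -> F).
Hypothesis x0 : forall i, x i != 0.
Hypothesis sigma_x0 : forall i, sigma (x i ^+ 2) != 0.

Let t i := trace2 (x i).

Lemma trace2D i j : t j + t i
  = (x i ^- 2 * x j ^- 2) * ((x j ^+ 2 + x i ^+ 2) * (1 + x i ^+ 2 * x j ^+ 2)).
Proof. by rewrite /t /trace2; field; rewrite !x0. Qed.

(** Every [x i ^- 2] occurs in [2 n - 1] pairs, which gives the exponent [- 4 n + 2]. *)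
Lemma prod_lt_trace2D : (0 < n)%N ->
  prod_lt (fun i j => t j + t i)
  = (\prod_(i < n.*2) x i ^ (- (4 * n)%:Z + 2))
    * prod_lt (fun i j => (x j ^+ 2 + x i ^+ 2) * (1 + x i ^+ 2 * x j ^+ 2)).
Proof.
move=> n0; transitivity (prod_lt (fun i j => x i ^- 2 * x j ^- 2)
    * prod_lt (fun i j => (x j ^+ 2 + x i ^+ 2) * (1 + x i ^+ 2 * x j ^+ 2))).
  by rewrite -prod_ltM; apply: eq_prod_lt => i j _; apply: trace2D.
congr (_ * _).
have X0 : \prod_i x i ^- 2 != 0.
  by apply/prodf_neq0 => i _; rewrite invr_neq0 ?expf_neq0.
apply: (mulIf X0); rewrite prod_lt_sym -prodrXl -big_split.
apply: eq_bigr => i _ /=; rewrite exprnN [LHS]exprnP exprz_exp -expfzDr //.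
by congr (_ ^ _); lia.
Qed.

Lemma Hf_trace2D :
  Hf (\matrix_(i < n.*2, j < n.*2) (t j + t i)^-1)
  = (\prod_i x i ^+ 2)
    * Hf (\matrix_(i, j) ((x j ^+ 2 + x i ^+ 2) * (1 + x i ^+ 2 * x j ^+ 2))^-1).
Proof.
rewrite -Hf_scale; apply: eq_Hf => i j _; rewrite !mxE trace2D.
by rewrite !invfM !invrK.
Qed.

Section Fourth.

Variable a : F.
Hypothesis a2 : a ^+ 2 = -1.
Hypothesis charF : [pchar F] =i pred0.
Hypothesis t_inj : injective t.
Hypothesis tD0 : forall i j, t i + t j != 0.

Lemma trace2_fourth : trace2 a = - 2.
Proof. by rewrite /trace2 a2 invrN invr1; ring. Qed.

Lemma quad_fourth u v : quad (trace2 a) u v = (v + u) ^+ 2.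
Proof. by rewrite /quad trace2_fourth; ring. Qed.

(** Here [sigma a = 2 a]. The fourth power suffices, as the exponent [- 4 n^2 + 4 n] is a multiple
    of [4]. *)
Lemma sigma_fourth4 : sigma a ^+ 4 = 2 ^+ 4.
Proof.
have a0 : a != 0 by apply: contra_eq_neq a2 => ->; rewrite expr0n eq_sym oppr_eq0 oner_eq0.
have -> : sigma a = 2 * a.
  rewrite /sigma; transitivity (a + a ^+ 2 * a^-1); first by rewrite a2 mulN1r.
  by field; rewrite a0.
by rewrite exprMn -[4%N]/(2 * 2)%N !exprM a2; ring.
Qed.

Lemma sigma_fourth_exp :
  sigma a ^ (- (4 * n ^ 2)%:Z + (4 * n)%:Z) = 2 ^ (- (4 * n ^ 2)%:Z + (4 * n)%:Z).
Proof.
have -> : - (4 * n ^ 2)%:Z + (4 * n)%:Z = 4%:Z * (n%:Z - (n ^ 2)%:Z) by lia.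
by rewrite -!exprz_exp -!exprnP sigma_fourth4.
Qed.

Let diff0 : prod_lt (fun i j => t j - t i) != 0.
Proof.
apply: prod_lt_neq0 => i j ij; rewrite subr_eq0 (inj_eq t_inj) -val_eqE /=.
by rewrite gtn_eqF.
Qed.

Let quad0 (i j : 'I_n.*2) : (i < j)%N -> quad (trace2 a) (t i) (t j) != 0.
Proof. by move=> _; rewrite quad_fourth expf_neq0. Qed.

Let a0 : a != 0.
Proof. by apply: contra_eq_neq a2 => ->; rewrite expr0n eq_sym oppr_eq0 oner_eq0. Qed.

Lemma prod_lt_quad_fourth :
  prod_lt (fun i j => quad (trace2 a) (t i) (t j))
  = prod_lt (fun i j => t j + t i) ^+ 2.
Proof.
by rewrite expr2 -prod_ltM; apply: eq_prod_lt => i j _; rewrite quad_fourth.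
Qed.

(** The product of the [quad] is the square of that of the [t_j + t_i]. One copy is absorbed by
    [Pf_Hf], and passing to the Hafnian in [x] raises the exponent of each [x i] by [2]. *)
Lemma A1_fourth : (0 < n)%N -> A1_UO x a
  = 2 ^ (- (4 * n ^ 2)%:Z + (4 * n)%:Z)
    * (\prod_(i < n.*2) x i ^ (- (4 * n)%:Z + 4))
    * prod_lt (fun i j => (x j ^+ 2 + x i ^+ 2) * (1 + x i ^+ 2 * x j ^+ 2))
    * Hf (\matrix_(i < n.*2, j < n.*2)
            ((x j ^+ 2 + x i ^+ 2) * (1 + x i ^+ 2 * x j ^+ 2))^-1).
Proof.
move=> n0; rewrite A1_reduction // sigma_fourth_exp prod_lt_quad_fourth.
rewrite (@eq_Pf _ _ _ (\matrix_(i, j) ((t j - t i) / (t j + t i) ^+ 2))); last first.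
  by move=> i j _; rewrite !mxE quad_fourth.
have := Pf_Hf charF t_inj tD0; set P := Pf _ => e.
set c := 2 ^ _.
transitivity (c * (prod_lt (fun i j => t j + t i) / prod_lt (fun i j => t j - t i))
  * (P * prod_lt (fun i j => t j + t i))); first by ring.
rewrite e Hf_trace2D.
transitivity (c * prod_lt (fun i j => t j + t i) * ((\prod_i x i ^+ 2)
    * Hf (\matrix_(i, j) ((x j ^+ 2 + x i ^+ 2) * (1 + x i ^+ 2 * x j ^+ 2))^-1))).
  by field.
rewrite prod_lt_trace2D //.
have -> : \prod_(i < n.*2) x i ^ (- (4 * n)%:Z + 4)
  = (\prod_(i < n.*2) x i ^ (- (4 * n)%:Z + 2)) * \prod_i x i ^+ 2.
  rewrite -big_split; apply: eq_bigr => i _ /=; rewrite exprnP -expfzDr //.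
  by congr (_ ^ _); lia.
by ring.
Qed.

(** The left side is that of [A2_reduction] after cancellation, hence meaningful where [A2_UO]
    itself is [0/0]. As [trace2 a + 2 = 0], the entries become those of [Pf_Schur]. *)
Lemma A2_fourth_value : (0 < n)%N ->
  sigma a ^ (- (4 * n ^ 2)%:Z + (4 * n)%:Z)
  * (prod_lt (fun i j => quad (trace2 a) (t i) (t j)) / prod_lt (fun i j => t j - t i))
  * Pf (\matrix_(i, j) ((t j - t i) * (trace2 a + 2 + t i + t j)
                         / quad (trace2 a) (t i) (t j)))
  = 2 ^ (- (4 * n ^ 2)%:Z + (4 * n)%:Z)
    * (\prod_(i < n.*2) x i ^ (- (4 * n)%:Z + 2))
    * prod_lt (fun i j => (x j ^+ 2 + x i ^+ 2) * (1 + x i ^+ 2 * x j ^+ 2)).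
Proof.
move=> n0; rewrite sigma_fourth_exp prod_lt_quad_fourth.
rewrite (@eq_Pf _ _ _ (\matrix_(i, j) ((t j - t i) / (t j + t i)))); last first.
  move=> i j _; rewrite !mxE quad_fourth trace2_fourth.
  by field; rewrite addrC tD0.
have := Pf_Schur t_inj tD0; set P := Pf _ => e.
rewrite -[RHS]mulrA -prod_lt_trace2D //; set c := 2 ^ _.
transitivity (c * (prod_lt (fun i j => t j + t i) / prod_lt (fun i j => t j - t i))
  * (P * prod_lt (fun i j => t j + t i))); first by ring.
by rewrite e; field.
Qed.

End Fourth.

Section Sixth.

Variable a : F.
Hypothesis a2 : a ^+ 2 - a + 1 = 0.

Let tau i := t i ^+ 3 - 3 * t i.
Hypothesis tau_inj : injective tau.

Let t_inj : injective t.
Proof. by move=> i j e; apply: tau_inj; rewrite /tau e. Qed.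

Let a0 : a != 0.
Proof.
by apply: contra_eq_neq a2 => ->; rewrite expr0n subrr add0r oner_eq0.
Qed.

Let aV : a^-1 = 1 - a.
Proof.
apply: (mulfI a0); rewrite mulfV //.
by apply/eqP; rewrite -subr_eq0 -[X in _ == X]a2; apply/eqP; ring.
Qed.

Lemma trace2_sixth : trace2 a = -1.
Proof.
rewrite /trace2 -exprVn aV; transitivity (2 * (a ^+ 2 - a + 1) - 1); first by ring.
by rewrite a2 mulr0 add0r.
Qed.

(** Here [sigma a = 2 a - 1], whose square is [4 (a^2 - a + 1) - 3 = -3]. *)
Lemma sigma_sixth4 : sigma a ^+ 4 = 3 ^+ 2.
Proof.
rewrite /sigma aV.
transitivity ((4 * (a ^+ 2 - a + 1) - 3) ^+ 2); first by ring.
by rewrite a2; ring.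
Qed.

Lemma sigma_sixth_exp :
  sigma a ^ (- (4 * n ^ 2)%:Z + (4 * n)%:Z) = 3 ^ (- (2 * n ^ 2)%:Z + (2 * n)%:Z).
Proof.
have -> : - (4 * n ^ 2)%:Z + (4 * n)%:Z = 4%:Z * (n%:Z - (n ^ 2)%:Z) by lia.
have -> : - (2 * n ^ 2)%:Z + (2 * n)%:Z = 2%:Z * (n%:Z - (n ^ 2)%:Z) by lia.
by rewrite -!exprz_exp -!exprnP sigma_sixth4.
Qed.

Lemma quad_sixth i j : tau j - tau i = (t j - t i) * quad (trace2 a) (t i) (t j).
Proof. by rewrite /quad trace2_sixth /tau; ring. Qed.

Let tau0 (i j : 'I_n.*2) : (i < j)%N -> tau j - tau i != 0.
Proof. by move=> ij; rewrite subr_eq0 (inj_eq tau_inj) -val_eqE /= gtn_eqF. Qed.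

Let t0 (i j : 'I_n.*2) : (i < j)%N -> t j - t i != 0.
Proof. by move=> ij; rewrite subr_eq0 (inj_eq t_inj) -val_eqE /= gtn_eqF. Qed.

Let quad0 (i j : 'I_n.*2) : (i < j)%N -> quad (trace2 a) (t i) (t j) != 0.
Proof.
by move=> /tau0; rewrite quad_sixth mulf_eq0 negb_or => /andP[].
Qed.

(** [Pf_bialternant] with nodes [tau]. The family [b] stays free: [b = t] yields the square of the
    symplectic character, [b = t^2 + t - 1] its product with the orthogonal one. *)
Lemma Pf_sixth (b : 'I_n.*2 -> F) :
  prod_lt (fun i j => quad (trace2 a) (t i) (t j)) / prod_lt (fun i j => t j - t i)
  * Pf (\matrix_(i, j) ((t j - t i) * (b j - b i) / (tau j - tau i)))
  = (bialternant tau t / prod_lt (fun i j => t j - t i))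
    * (bialternant tau b / prod_lt (fun i j => t j - t i)).
Proof.
have t00 := prod_lt_neq0 t0.
have := Pf_bialternant t b tau_inj.
have -> : prod_lt (fun i j => tau j - tau i) = prod_lt (fun i j => t j - t i)
    * prod_lt (fun i j => quad (trace2 a) (t i) (t j)).
  by rewrite -prod_ltM; apply: eq_prod_lt => i j _; apply: quad_sixth.
set P := Pf _ => e.
transitivity (P * (prod_lt (fun i j => t j - t i)
   * prod_lt (fun i j => quad (trace2 a) (t i) (t j)))
   / prod_lt (fun i j => t j - t i) ^+ 2); first by field.
by rewrite e; field.
Qed.

Lemma Sp_char_sixth : (0 < n)%N ->
  Sp_char (delta2 (n%:Z - 1) (n%:Z - 1)) (fun i => x i ^+ 2)
  = bialternant tau t / prod_lt (fun i j => t j - t i).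
Proof.
move=> n0; rewrite Sp_char_bialternant //; last by move=> i; rewrite expf_neq0.
congr (_ / _); apply: eq_bialternant => i //.
by rewrite /tau /t /trace2; field.
Qed.

Lemma A1_sixth : (0 < n)%N -> A1_UO x a
  = 3 ^ (- (2 * n ^ 2)%:Z + (2 * n)%:Z)
    * Sp_char (delta2 (n%:Z - 1) (n%:Z - 1)) (fun i => x i ^+ 2) ^+ 2.
Proof.
move=> n0; rewrite A1_reduction // sigma_sixth_exp -mulrA; congr (_ * _).
rewrite Sp_char_sixth // expr2 -Pf_sixth; congr (_ * _); apply: eq_Pf => i j ij.
by rewrite !mxE quad_sixth -mulf_div divff ?mul1r ?t0.
Qed.

Lemma A2_sixth c : (0 < n)%N -> c ^+ 2 = -1 -> sigma a != 0 -> A2_UO x a c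
  = 3 ^ (- (2 * n ^ 2)%:Z + (2 * n)%:Z)
    * Sp_char (delta2 (n%:Z - 1) (n%:Z - 1)) (fun i => x i ^+ 2)
    * tildeO_char (delta2 n%:Z (n%:Z - 1)) x.
Proof.
move=> n0 c2 sa0; rewrite A2_reduction //; last first.
  by rewrite aV addrC subrK oner_eq0.
rewrite sigma_sixth_exp.
have sx i : x i - (x i)^-1 != 0.
  apply: contraNneq (sigma_x0 i) => e.
  have -> : sigma (x i ^+ 2) = (x i + (x i)^-1) * (x i - (x i)^-1).
    by rewrite /sigma; field.
  by rewrite e mulr0.
rewrite Sp_char_sixth // tildeO_char_bialternant //.
rewrite (@eq_bialternant _ _ (fun i => x i ^+ 6 + x i ^- 6) tau _
  (fun i => t i ^+ 2 + t i - 1)) //; last first.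
  by move=> i; rewrite /tau /t /trace2; field.
rewrite -[LHS]mulrA -[RHS]mulrA -Pf_sixth; congr (_ * (_ * _)); apply: eq_Pf => i j ij.
(* For [b = t^2 + t - 1] one has [b_j - b_i = (t_j - t_i) (t_i + t_j + 1)], and
   [trace2 a + 2 = 1]. *)
rewrite !mxE quad_sixth -/(t i) -/(t j); have := quad0 ij.
by rewrite trace2_sixth => q0; field; rewrite q0 t0.
Qed.

End Sixth.

End Specialisations.

(** * Values of rational functions *)

Section HasValue.

Variables (K : fieldType) (a : K).
Implicit Types f g : uratfun K.

Let tofrac_neq0 (q : {poly K}) : q.[a] != 0 -> tofrac q != 0 :> uratfun K.
Proof. by rewrite tofrac_eq0; apply: contraNneq => ->; rewrite horner0. Qed.

Lemma has_value_const c : has_value_at (uratfun_const c) a c.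
Proof.
by exists c%:P, 1; split; rewrite ?hornerE ?oner_neq0 // ?rmorph1 divr1.
Qed.

Lemma has_value_var : has_value_at (uratfun_var K) a a.
Proof. by exists 'X, 1; split; rewrite ?hornerE ?oner_neq0 // ?rmorph1 divr1. Qed.

Lemma has_valueD f g u v : has_value_at f a u -> has_value_at g a v ->
  has_value_at (f + g) a (u + v).
Proof.
move=> [p [q [q0 -> ->]]] [p' [q' [q'0 -> ->]]].
exists (p * q' + p' * q), (q * q'); split.
- by rewrite hornerM mulf_neq0.
- by rewrite rmorphD !rmorphM /= addf_div ?tofrac_neq0.
- by rewrite hornerD !hornerM addf_div.
Qed.

Lemma has_valueN f u : has_value_at f a u -> has_value_at (- f) a (- u).
Proof.
move=> [p [q [q0 -> ->]]]; exists (- p), q; split=> //.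
  by rewrite rmorphN mulNr.
by rewrite hornerN mulNr.
Qed.

Lemma has_valueM f g u v : has_value_at f a u -> has_value_at g a v ->
  has_value_at (f * g) a (u * v).
Proof.
move=> [p [q [q0 -> ->]]] [p' [q' [q'0 -> ->]]].
exists (p * p'), (q * q'); split.
- by rewrite hornerM mulf_neq0.
- by rewrite !rmorphM /= mulf_div.
- by rewrite !hornerM mulf_div.
Qed.

(** Lets nonvanishing in [K(X)] be read off at the point [a]. *)
Lemma has_value_neq0 f u : has_value_at f a u -> u != 0 -> f != 0.
Proof.
move=> [p [q [q0 -> ->]]] pq0.
have p0 : p.[a] != 0 by apply: contraNneq pq0 => ->; rewrite mul0r.
exact: mulf_neq0 (tofrac_neq0 p0) (invr_neq0 (tofrac_neq0 q0)).
Qed.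

Lemma has_valueV f u : has_value_at f a u -> u != 0 -> has_value_at f^-1 a u^-1.
Proof.
move=> [p [q [q0 -> ->]]]; rewrite mulf_eq0 negb_or => /andP[p0 _].
by exists q, p; split; rewrite ?invf_div.
Qed.

Lemma has_value1 : has_value_at 1 a 1.
Proof. by have := has_value_const 1; rewrite /uratfun_const polyC1 rmorph1. Qed.

Lemma has_value0 : has_value_at 0 a 0.
Proof. by have := has_value_const 0; rewrite /uratfun_const polyC0 rmorph0. Qed.

Lemma has_value_nat m : has_value_at m%:R a m%:R.
Proof.
elim: m => [|m IHm]; first exact: has_value0.
by rewrite !mulrS; apply: has_valueD => //; apply: has_value1.
Qed.

Lemma has_valueX f u m : has_value_at f a u -> has_value_at (f ^+ m) a (u ^+ m).
Proof.
move=> fu; elim: m => [|m IHm]; first by rewrite !expr0; apply: has_value1.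
by rewrite !exprS; apply: has_valueM.
Qed.

Lemma has_valueXz f u (z : int) : has_value_at f a u -> u != 0 ->
  has_value_at (f ^ z) a (u ^ z).
Proof.
move=> fu u0; case: z => m; first by rewrite -!exprnP; apply: has_valueX.
by rewrite !NegzE -!exprnN; apply: has_valueV; rewrite ?expf_neq0 //; apply: has_valueX.
Qed.

Lemma has_value_sum (I : finType) (P : pred I) (f : I -> uratfun K) (u : I -> K) :
  (forall i, has_value_at (f i) a (u i)) ->
  has_value_at (\sum_(i | P i) f i) a (\sum_(i | P i) u i).
Proof.
move=> fu; apply: (big_ind2 (fun g v => has_value_at g a v)) => //.
  exact: has_value0.
by move=> *; apply: has_valueD.
Qed.

Lemma has_value_prod (I : finType) (P : pred I) (f : I -> uratfun K) (u : I -> K) :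
  (forall i, has_value_at (f i) a (u i)) ->
  has_value_at (\prod_(i | P i) f i) a (\prod_(i | P i) u i).
Proof.
move=> fu; apply: (big_ind2 (fun g v => has_value_at g a v)) => //.
  exact: has_value1.
by move=> *; apply: has_valueM.
Qed.

Lemma has_value_prod_lt m (f : 'I_m -> 'I_m -> uratfun K) (u : 'I_m -> 'I_m -> K) :
  (forall i j, has_value_at (f i j) a (u i j)) ->
  has_value_at (prod_lt f) a (prod_lt u).
Proof. by move=> fu; apply: has_value_prod => i; apply: has_value_prod. Qed.

Lemma has_value_Pf n (A : 'M[uratfun K]_n.*2) (B : 'M[K]_n.*2) :
  (forall i j, has_value_at (A i j) a (B i j)) -> has_value_at (Pf A) a (Pf B).
Proof.
move=> AB; apply: has_value_sum => s; apply: has_valueM; last exact: has_value_prod.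
by apply/has_valueX/has_valueN/has_value1.
Qed.

End HasValue.

Section FourthValue.

Variables (K : fieldType) (n : nat) (x : 'I_n.*2 -> K) (a : K).
Hypotheses (n0 : (0 < n)%N) (charK : [pchar K] =i pred0) (a2 : a ^+ 2 = -1).
Hypothesis x0 : forall i, x i != 0.
Hypothesis sigma_x0 : forall i, sigma (x i ^+ 2) != 0.
Hypothesis t_inj : injective (fun i => trace2 (x i)).
Hypothesis tD0 : forall i j, trace2 (x i) + trace2 (x j) != 0.

(** [A2_reduction] is applied over [K(X)] with the indeterminate in place of [a], where [X + X^-1]
    is nonzero and cancels; the reduced expression is then evaluated factor by factor. *)
Lemma A2_fourth :
  has_value_at (A2_UO (fun i => uratfun_const (x i)) (uratfun_var K) (uratfun_const a)) a
    (2 ^ (- (4 * n ^ 2)%:Z + (4 * n)%:Z)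
    * (\prod_(i < n.*2) x i ^ (- (4 * n)%:Z + 2))
    * prod_lt (fun i j => (x j ^+ 2 + x i ^+ 2) * (1 + x i ^+ 2 * x j ^+ 2))).
Proof.
have a0 : a != 0 by apply: contra_eq_neq a2 => ->; rewrite expr0n eq_sym oppr_eq0 oner_eq0.
have hX := has_value_var a.
have hc c := has_value_const a c.
have htr f u : has_value_at f a u -> u != 0 -> has_value_at (trace2 f) a (trace2 u).
  move=> fu u0; apply: has_valueD; first exact: has_valueX.
  by apply: has_valueV; [apply: has_valueX | rewrite expf_neq0].
have hsg f u : has_value_at f a u -> u != 0 -> has_value_at (sigma f) a (sigma u).
  by move=> fu u0; apply/(has_valueD fu)/has_valueN/has_valueV.
pose X i := uratfun_const (x i) : uratfun K.
pose t i := trace2 (x i).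
have ht i : has_value_at (trace2 (X i)) a (t i) by apply: htr (hc _) (x0 _).
have h2 : has_value_at 2 a 2 by apply: (has_value_nat a 2).
have hq i j : has_value_at (quad (trace2 (uratfun_var K)) (trace2 (X i)) (trace2 (X j))) a
    (quad (trace2 a) (t i) (t j)).
  have h4 : has_value_at 4 a 4 by apply: (has_value_nat a 4).
  apply: has_valueD (has_valueN h4); apply: has_valueD (has_valueX _ (ht j)).
  apply: has_valueD (has_valueX _ (ht i)); apply: has_valueD (has_valueX _ (htr _ _ hX a0)) _.
  by apply/has_valueN/has_valueM => //; apply: has_valueM => //; apply: htr.
have n2 : 2%:R != 0 :> K by rewrite (pcharf0P K).1.
have q0 i j : quad (trace2 a) (t i) (t j) != 0.
  by rewrite quad_fourth // expf_neq0 // addrC; apply: tD0.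
have s0 : sigma a != 0.
  have : sigma a ^+ 4 != 0 by rewrite sigma_fourth4 // expf_neq0.
  by rewrite expf_eq0.
have c2 : uratfun_const a ^+ 2 = -1.
  by rewrite /uratfun_const -rmorphXn -polyC_exp /= a2 polyCN polyC1 rmorphN rmorph1.
have d0 : prod_lt (fun i j => t j - t i) != 0.
  apply: prod_lt_neq0 => i j ij; rewrite subr_eq0 (inj_eq t_inj) -val_eqE /=.
  by rewrite gtn_eqF.
(* Otherwise [X^2 + 1] would be the zero polynomial. Evaluation at [a] cannot decide this, since
   [a + a^-1 = 0]. *)
have varD0 : uratfun_var K + (uratfun_var K)^-1 != 0.
  have v0 := has_value_neq0 hX a0.
  apply: contraTneq isT => e.
  have : uratfun_var K ^+ 2 + 1 == 0.
    by rewrite -[X in _ == X](mulr0 (uratfun_var K)) -e mulrDr divff // expr2.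
  have -> : uratfun_var K ^+ 2 + 1 = tofrac ('X^2 + 1) by rewrite rmorphD rmorph1 rmorphXn.
  rewrite tofrac_eq0 => /eqP/(congr1 (size \o polyseq)) /=.
  by rewrite size_polyDl size_polyXn ?size_poly1 // size_poly0.
have X0 i : X i != 0 := has_value_neq0 (hc (x i)) (x0 i).
have var0 := has_value_neq0 hX a0.
have sX0 i : sigma (X i ^+ 2) != 0.
  apply: (has_value_neq0 _ (sigma_x0 i)); apply: hsg; first exact: has_valueX (hc _).
  by rewrite expf_neq0.
have qX0 (i j : 'I_n.*2) : (i < j)%N ->
    quad (trace2 (uratfun_var K)) (trace2 (X i)) (trace2 (X j)) != 0.
  by move=> _; apply: has_value_neq0 (hq i j) (q0 i j).
have sv := hsg _ _ hX a0.
have dX i j : has_value_at (trace2 (X j) - trace2 (X i)) a (t j - t i).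
  exact: has_valueD (ht j) (has_valueN (ht i)).
rewrite (A2_reduction X0 var0 sX0 qX0 c2 (has_value_neq0 sv s0) varD0).
rewrite -(A2_fourth_value x0 a2 t_inj tD0 n0); apply: has_valueM.
  apply: has_valueM; first exact: has_valueXz sv s0.
  apply: has_valueM; first exact: has_value_prod_lt hq.
  exact: has_valueV (has_value_prod_lt dX) d0.
apply: has_value_Pf => i j; rewrite !mxE; apply: has_valueM.
  apply: has_valueM; first exact: dX.
  exact: has_valueD (has_valueD (has_valueD (htr _ _ hX a0) h2) (ht i)) (ht j).
exact: has_valueV (hq i j) (q0 i j).
Qed.

End FourthValue.

(** * Quadratic equations of the roots of unity *)

Section Zeta.

Variable R : realType.

Lemma zeta4_sqr : zeta R 4 ^+ 2 = -1.
Proof.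
rewrite /zeta (_ : 2 * trigo.pi / 4 = trigo.pi / 2); last by field.
rewrite trigo.cos_pihalf trigo.sin_pihalf expr2; apply/eqP.
by rewrite eq_complex /=; apply/andP; split; apply/eqP; ring.
Qed.

(** For [c = cos (pi / 3)], expanding [cos pi = -1] as a triple angle gives
    [(c + 1) (2 c - 1)^2 = 0], and [c > 0] excludes [c = -1]. *)
Lemma cos_pi_third : trigo.cos (2 * trigo.pi / 6) = 1 / 2 :> R.
Proof.
set th : R := 2 * trigo.pi / 6; set c := trigo.cos th.
have c0 : 0 < c.
  apply: trigo.cos_gt0_pihalf; have := trigo.pi_gt0 R; rewrite /th; lra.
have : trigo.cos (th + th + th) = -1.
  by rewrite (_ : th + th + th = trigo.pi) ?trigo.cospi // /th; field.
rewrite !trigo.cosD trigo.sinD -/c; have := trigo.cos2Dsin2 th; rewrite -/c.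
set s := trigo.sin th => cs e.
have : (c + 1) * (2 * c - 1) ^+ 2 = 0.
  transitivity ((c * c - s * s) * c - (s * c + c * s) * s + 1
    + (c ^+ 2 + s ^+ 2 - 1) * (3 * c)); first by ring.
  by rewrite cs e; ring.
move/eqP; rewrite mulf_eq0 gt_eqF ?addr_gt0 //= expf_eq0 /= subr_eq0 => /eqP e2.
lra.
Qed.

Lemma zeta6_eq : zeta R 6 ^+ 2 - zeta R 6 + 1 = 0.
Proof.
rewrite /zeta cos_pi_third; have := trigo.cos2Dsin2 (2 * trigo.pi / 6 : R).
rewrite cos_pi_third; set s := trigo.sin _ => cs; apply/eqP.
rewrite expr2 eq_complex /=; apply/andP; split; apply/eqP; last by field.
transitivity (1 - ((1 / 2) ^+ 2 + s ^+ 2)); last by rewrite cs subrr.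
by field.
Qed.

End Zeta.

(** * Nonvanishing conditions for the indeterminates *)

Lemma sigma_sqr_factor (F : fieldType) (x : F) : x != 0 ->
  sigma (x ^+ 2) = (x ^+ 4 - 1) / x ^+ 2.
Proof. by move=> x0; rewrite /sigma; field. Qed.

Lemma trace2D_factor (F : fieldType) (x y : F) : x != 0 -> y != 0 ->
  trace2 x + trace2 y
  = (x ^+ 2 + y ^+ 2) * (1 + x ^+ 2 * y ^+ 2) / (x ^+ 2 * y ^+ 2).
Proof. by move=> x0 y0; rewrite /trace2; field; rewrite x0 y0. Qed.

Lemma tau_factor (F : fieldType) (x y : F) : x != 0 -> y != 0 ->
  trace2 x ^+ 3 - 3 * trace2 x - (trace2 y ^+ 3 - 3 * trace2 y)
  = (x ^+ 6 - y ^+ 6) * (x ^+ 6 * y ^+ 6 - 1) / (x ^+ 6 * y ^+ 6).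
Proof. by move=> x0 y0; rewrite /trace2; field; rewrite x0 y0. Qed.

Section Generic.

Import mpoly.

Variables (C : numClosedFieldType) (m : nat).

Let K := ratfun C m.
Let x (i : 'I_m) : K := ratfun_var C i.
(** A test point with distinct integer coordinates at least [2]: there [x_i^4] and [(x_i x_j)^6]
    differ from [1], and [x_i^6] from [x_j^6] for distinct indices. *)
Let pt (i : 'I_m) : C := i.+2%:R.

Lemma tofrac_meval_neq0 (p : {mpoly C[m]}) :
  p.@[pt] != 0 -> tofrac p != 0 :> K.
Proof. by rewrite tofrac_eq0; apply: contraNneq => ->; rewrite rmorph0. Qed.

Lemma meval_var (i : 'I_m) : ('X_i : {mpoly C[m]}).@[pt] = pt i.
Proof. exact: mevalXU. Qed.

Lemma ratfun_pchar : [pchar K] =i pred0.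
Proof.
apply/pcharf0P => -[|k]; first by rewrite !eqxx.
apply/negbTE; rewrite (_ : k.+1%:R = tofrac (k.+1%:R : {mpoly C[m]}) :> K).
  by rewrite tofrac_meval_neq0 // rmorph_nat pnatr_eq0.
by rewrite rmorph_nat.
Qed.

Lemma ratfun_var_neq0 i : x i != 0.
Proof. by rewrite tofrac_meval_neq0 // meval_var pnatr_eq0. Qed.

Lemma ratfun_monomial_neq a b c d (i j : 'I_m) :
  (i.+2 ^ a * j.+2 ^ b != i.+2 ^ c * j.+2 ^ d)%N ->
  x i ^+ a * x j ^+ b != x i ^+ c * x j ^+ d.
Proof.
move=> ne; rewrite -subr_eq0 -!rmorphXn -!rmorphM -rmorphB /= tofrac_meval_neq0 //.
rewrite rmorphB !rmorphM !rmorphXn /= !meval_var /pt -!natrX -!natrM.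
by rewrite subr_eq0 eqr_nat.
Qed.

Lemma ratfun_monomialD_neq0 a b c d (i j : 'I_m) :
  x i ^+ a * x j ^+ b + x i ^+ c * x j ^+ d != 0.
Proof.
rewrite -!rmorphXn -!rmorphM -rmorphD /= tofrac_meval_neq0 //.
rewrite rmorphD !rmorphM !rmorphXn /= !meval_var /pt -!natrX -!natrM -natrD.
by rewrite pnatr_eq0 addn_eq0 muln_eq0 !expn_eq0.
Qed.

Lemma ratfun_constXn (a : C) k : ratfun_const m a ^+ k = ratfun_const m (a ^+ k).
Proof. by rewrite /ratfun_const -rmorphXn -rmorphXn. Qed.

Lemma ratfun_const1 : ratfun_const m 1 = 1 :> K.
Proof. by rewrite /ratfun_const !rmorph1. Qed.

Lemma ratfun_constD (a b : C) :
  ratfun_const m (a + b) = ratfun_const m a + ratfun_const m b.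
Proof. by rewrite /ratfun_const -rmorphD -rmorphD. Qed.

Lemma ratfun_constN (a : C) : ratfun_const m (- a) = - ratfun_const m a.
Proof. by rewrite /ratfun_const -rmorphN -rmorphN. Qed.

Lemma ratfun_const0 : ratfun_const m 0 = 0 :> K.
Proof. by rewrite /ratfun_const !rmorph0. Qed.

Lemma sigma_var_neq0 i : sigma (x i ^+ 2) != 0.
Proof.
have x0 := ratfun_var_neq0 i.
rewrite (sigma_sqr_factor x0); apply: mulf_neq0; last by rewrite invr_neq0 ?expf_neq0.
have := @ratfun_monomial_neq 4 0 0 0 i i.
rewrite !expr0 !mulr1 subr_eq0; apply.
by rewrite !expn0 !muln1 -[1%N](exp1n 4) eqn_exp2r.
Qed.

Lemma trace2D_var_neq0 i j : trace2 (x i) + trace2 (x j) != 0.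
Proof.
have x0 := ratfun_var_neq0; rewrite (trace2D_factor (x0 i) (x0 j)).
apply: mulf_neq0; last by rewrite invr_neq0 // mulf_neq0 ?expf_neq0.
apply: mulf_neq0.
  by have := ratfun_monomialD_neq0 2 0 0 2 i j; rewrite !expr0 mulr1 mul1r.
by have := ratfun_monomialD_neq0 0 0 2 2 i j; rewrite !expr0 mulr1.
Qed.

Lemma tau_var_inj : injective (fun i => trace2 (x i) ^+ 3 - 3 * trace2 (x i)).
Proof.
move=> i j /eqP e; apply/eqP; apply: contraLR e => ij; rewrite -subr_eq0.
have x0 := ratfun_var_neq0; rewrite (tau_factor (x0 i) (x0 j)).
apply: mulf_neq0; last by rewrite invr_neq0 // mulf_neq0 ?expf_neq0.
apply: mulf_neq0; rewrite subr_eq0.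
  have := @ratfun_monomial_neq 6 0 0 6 i j; rewrite !expr0 mulr1 mul1r; apply.
  by rewrite !expn0 muln1 mul1n eqn_exp2r // !eqSS.
have := @ratfun_monomial_neq 6 6 0 0 i j; rewrite !expr0 mulr1; apply.
by rewrite !expn0 muln1 -expnMn -[1%N](exp1n 6) eqn_exp2r // muln_eq1.
Qed.

End Generic.

Theorem theorem2p4 (R : realType) (n : nat) (hn : (1 <= n)%N) :
  let K : fieldType := ratfun R[i] n.*2 in
  let x : 'I_n.*2 -> K := fun i => ratfun_var R[i] i in
  let z4 : K := ratfun_const n.*2 (zeta R 4) in
  let z6 : K := ratfun_const n.*2 (zeta R 6) in
  [/\ A1_UO x z4
      = 2 ^ (- (4 * n ^ 2)%:Z + (4 * n)%:Z)
        * (\prod_(i < n.*2) x i ^ (- (4 * n)%:Z + 4))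
        * (\prod_(i < n.*2) \prod_(j < n.*2 | (i < j)%N)
             ((x j ^+ 2 + x i ^+ 2) * (1 + x i ^+ 2 * x j ^+ 2)))
        * Hf (\matrix_(i < n.*2, j < n.*2)
                ((x j ^+ 2 + x i ^+ 2) * (1 + x i ^+ 2 * x j ^+ 2))^-1),
      A1_UO x z6
      = 3 ^ (- (2 * n ^ 2)%:Z + (2 * n)%:Z)
        * Sp_char (delta2 (n%:Z - 1) (n%:Z - 1)) (fun i => x i ^+ 2) ^+ 2,
      has_value_at
        (A2_UO (fun i => uratfun_const (x i)) (uratfun_var K) (uratfun_const z4))
        z4
        (2 ^ (- (4 * n ^ 2)%:Z + (4 * n)%:Z)
         * (\prod_(i < n.*2) x i ^ (- (4 * n)%:Z + 2))
         * (\prod_(i < n.*2) \prod_(j < n.*2 | (i < j)%N)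
              ((x j ^+ 2 + x i ^+ 2) * (1 + x i ^+ 2 * x j ^+ 2))))
    & A2_UO x z6 z4
      = 3 ^ (- (2 * n ^ 2)%:Z + (2 * n)%:Z)
        * Sp_char (delta2 (n%:Z - 1) (n%:Z - 1)) (fun i => x i ^+ 2)
        * tildeO_char (delta2 n%:Z (n%:Z - 1)) x].
Proof.
move=> K x z4 z6.
have charK : [pchar K] =i pred0 := @ratfun_pchar _ _.
have x0 : forall i, x i != 0 := @ratfun_var_neq0 _ _.
have s0 : forall i, sigma (x i ^+ 2) != 0 := @sigma_var_neq0 _ _.
have tD0 : forall i j, trace2 (x i) + trace2 (x j) != 0 := @trace2D_var_neq0 _ _.
have tau_inj : injective (fun i => trace2 (x i) ^+ 3 - 3 * trace2 (x i)).
  exact: tau_var_inj.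
have t_inj : injective (fun i => trace2 (x i)).
  by move=> i j e; apply: tau_inj; rewrite e.
have z4_sqr : z4 ^+ 2 = -1.
  by rewrite ratfun_constXn zeta4_sqr ratfun_constN ratfun_const1.
have z6_eq : z6 ^+ 2 - z6 + 1 = 0.
  rewrite ratfun_constXn -ratfun_constN -ratfun_constD.
  by rewrite -(ratfun_const1 R[i] n.*2) -ratfun_constD zeta6_eq ratfun_const0.
have sz6 : sigma z6 != 0.
  have : sigma z6 ^+ 4 != 0 by rewrite sigma_sixth4 // expf_neq0 // (pcharf0P K).1.
  by rewrite expf_eq0.
split.
- exact: A1_fourth.
- exact: A1_sixth.
- exact: A2_fourth.
- exact: A2_sixth.
Qed.
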